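(* Let $\rho>1$ and let $\mu_\rho$ denote the Boltzmann measure with parameter $\rho$. There exists a constant $c=c(\rho)>0$ such that for all $n\ge 1$ and for any Borel-measurable set $A\subset\mathbb{R}^n$ with $\mu_\rho^{\otimes n}(A)=t$, $$\max_{1\le i\le n} I_i^{\mathcal G}(A)\ge c\,t(1-t)\,\frac{(\log n)^{1-1/\rho}}{n},$$ where the geometric influences are with respect to $\mu_\rho^{\otimes n}$.
   Context: The Boltzmann measure $\mu_\rho$ with parameter $\rho\ge 1$ is the probability measure on $\mathbb{R}$ with density $\phi_\rho(x)=\frac{1}{2\Gamma(1+1/\rho)}e^{-|x|^\rho}$. Geometric influence: for a probability measure $\nu$ on $\mathbb{R}$ and a measurable $S\subseteq\mathbb{R}$, the lower Minkowski content is $\nu^+(S)=\liminf_{r\downarrow 0}\frac{\nu(S+[-r,r])-\nu(S)}{r}$ (Minkowski sum). For $A\subseteq\mathbb{R}^n$, $x\in\mathbb{R}^n$ and $1\le i\le n$, let $A_i^x=\{y\in\mathbb{R}:(x_1,\dots,x_{i-1},y,x_{i+1},\dots,x_n)\in A\}$. The geometric influence of the $i$th coordinate on $A$ with respect to $\nu^{\otimes n}$ is $I_i^{\mathcal G}(A)=\mathbb{E}_{x\sim\nu^{\otimes n}}[\nu^+(A_i^x)]\in[0,\infty]$. *)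

(* Defs.v *)
From HB Require Import structures.
From mathcomp Require Import all_boot all_order all_algebra.
From mathcomp Require Import all_classical all_reals all_analysis.
From mathcomp Require Import measurable_realfun.
Set Implicit Arguments.
Unset Strict Implicit.
Unset Printing Implicit Defensive.
Import Order.TTheory GRing.Theory Num.Theory.
Import numFieldNormedType.Exports.
Local Open Scope classical_set_scope.
Local Open Scope ring_scope.

Section cons_prob.
Context d (T : measurableType d) (R : realType) (n : nat).
Variables (P : probability T R) (Q : probability (n.-tuple T) R).
Local Open Scope ereal_scope.

Let tcons (x : T * n.-tuple T) : n.+1.-tuple T := [tuple of x.1 :: x.2].

Let measurable_tcons : measurable_fun [set: T * n.-tuple T] tcons.
Proof. exact: measurable_cons. Qed.

Definition cons_prob : set (n.+1.-tuple T) -> \bar R :=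
  pushforward (P \x Q) tcons.

Let cons_prob0 : cons_prob set0 = 0.
Proof. by rewrite /cons_prob /pushforward preimage_set0 measure0. Qed.

Let cons_prob_ge0 A : 0 <= cons_prob A.
Proof. exact: measure_ge0. Qed.

Let cons_prob_sigma_additive : semi_sigma_additive cons_prob.
Proof.
move=> F mF tF mUF; rewrite /cons_prob /pushforward preimage_bigcup.
apply: measure_semi_sigma_additive.
- by move=> k; rewrite -[X in measurable X]setTI; exact: measurable_tcons.
- apply/trivIsetP => /= i j _ _ ij; rewrite -preimage_setI.
  by move/trivIsetP : tF => /(_ _ _ _ _ ij) ->//; rewrite preimage_set0.
- by rewrite -preimage_bigcup -[X in measurable X]setTI; exact: measurable_tcons.
Qed.

HB.instance Definition _ := isMeasure.Build _ _ _
  cons_prob cons_prob0 cons_prob_ge0 cons_prob_sigma_additive.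

Let cons_probT : cons_prob [set: n.+1.-tuple T] = 1.
Proof.
rewrite /cons_prob /pushforward preimage_setT -setXTT.
by rewrite product_measure1E//= !probability_setT mule1.
Qed.

HB.instance Definition _ :=
  Measure_isProbability.Build _ _ _ cons_prob cons_probT.

End cons_prob.

(* The n-fold product of P.  The sigma-algebra of n.-tuple T is the one
   generated by the coordinates; for T = R it is the Borel sigma-algebra. *)
Fixpoint power_prob d (T : measurableType d) (R : realType)
    (P : probability T R) (n : nat) : probability (n.-tuple T) R :=
  if n is m.+1 then cons_prob P (power_prob P m) else \d_([tuple] : 0.-tuple T).

Lemma power_prob_box d (T : measurableType d) (R : realType)
    (P : probability T R) (n : nat) (B : 'I_n -> set T) :
  (forall i, measurable (B i)) ->
  power_prob P n [set x | forall i, B i (tnth x i)] = (\prod_(i < n) P (B i))%E.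
Proof.
elim: n B => [|n IH] B mB.
  by rewrite big_ord0 /= diracE mem_set// => -[].
have mC : measurable [set x : n.-tuple T | forall i, B (lift ord0 i) (tnth x i)].
  rewrite [X in measurable X](_ : _ =
      \bigcap_(i in [set: 'I_n]) ((@tnth n T)^~ i @^-1` B (lift ord0 i))).
    apply: fin_bigcap_measurable => // i _.
    by rewrite -[X in measurable X]setTI; exact: measurable_tnth.
  by apply/seteqP; split=> x /= h i; [move=> _|]; exact: h.
rewrite big_ord_recl -IH// /= /cons_prob /pushforward.
rewrite -product_measure1E//; congr (_ _); apply/seteqP; split=> -[a x] /=.
  move=> h; split=> [|i]; first by have := h ord0; rewrite tnth0.
  by have := h (lift ord0 i); rewrite tnthS.
by move=> [h0 h] i; case: (unliftP ord0 i) => [j|] ->; rewrite ?tnthS ?tnth0.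
Qed.

Section boltzmann.
Context {R : realType}.
Local Notation mu := (@lebesgue_measure R).

Definition Gamma (s : R) : R :=
  \int[mu]_(x in `]0, +oo[) (x `^ (s - 1) * expR (- x)).

Definition boltzmann_pdf (rho x : R) : R :=
  (2 * Gamma (1 + rho^-1))^-1 * expR (- `|x| `^ rho).

Let bfun (rho x : R) : R := expR (- `|x| `^ rho).

Let measurable_bfun (rho : R) : measurable_fun setT (bfun rho).
Proof.
apply: measurableT_comp => //; apply: measurableT_comp => //.
by apply: (measurableT_comp (measurable_powR _)); exact: normr_measurable.
Qed.

Let tailE (a : R) :
  (\int[mu]_(y in `]a, +oo[) (expR (- y))%:E = (expR (- a))%:E)%E.
Proof.
rewrite integral_itv_obnd_cbnd; last first.
  by apply/measurable_EFinP/measurable_funTS; apply: measurableT_comp.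
rewrite (@ge0_continuous_FTC2y _ _ (fun x => - expR (- x)) _ 0)//.
- by rewrite sub0e EFinN oppeK.
- apply: continuous_subspaceT => x.
  by apply: continuous_comp; [exact: opp_continuous|exact: continuous_expR].
- by rewrite -oppr0; apply: cvgN; exact: cvgr_expR.
- apply/cvg_at_right_filter; apply: cvgN.
  by apply: continuous_comp; [exact: opp_continuous|exact: continuous_expR].
- move=> x _; rewrite derive1N// derive1_comp// derive1N// derive1_id mulrN1 opprK.
  by rewrite derive1E; have /funeqP -> := @derive_expR R.
Qed.

Section normalization.
Variable rho : R.
Hypothesis rho_ge1 : 1 <= rho.

Let rho_gt0 : 0 < rho. Proof. exact: lt_le_trans rho_ge1. Qed.

(* expR (- `|x| `^ rho) is the integral of expR (- y) over y > `|x| `^ rho; the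
   normalization constant then follows from Tonelli's theorem applied to f. *)
Let f (z : R * R) : \bar R :=
  ((\1_[set w : R * R | `|w.1| `^ rho < w.2] z) * expR (- z.2))%:E.

Let mf : measurable_fun [set: measurableTypeR R * measurableTypeR R] f.
Proof.
apply/measurable_EFinP; apply: measurable_funM.
  apply: measurable_indic.
  have : measurable_fun setT (fun w : R * R => `|w.1| `^ rho < w.2).
    apply: measurable_fun_ltr => //.
    by apply: (measurableT_comp (measurable_powR _)); apply: measurableT_comp.
  by move=> /(_ measurableT [set true]); rewrite setTI; exact.
by apply: measurableT_comp => //; apply: measurableT_comp.
Qed.

Let f_ge0 z : (0 <= f z)%E.
Proof. by rewrite lee_fin mulr_ge0 ?expR_ge0. Qed.

Let fE x y : f (x, y) = (if `|x| `^ rho < y then expR (- y) else 0)%:E.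
Proof.
rewrite /f indicE/=; case: ifPn => h; first by rewrite mem_set// mul1r.
by rewrite memNset ?mul0r//=; exact/negP.
Qed.

Let integral_y x : (\int[mu]_y f (x, y) = (bfun rho x)%:E)%E.
Proof.
rewrite /bfun -tailE [RHS]integral_mkcond; apply: eq_integral => y _.
by rewrite fE patchE mem_setE/= in_itv/= andbT; case: ifP.
Qed.

Let g (y : R) : \bar R := (y `^ rho^-1 * expR (- y))%:E.

Let integral_x y :
  (\int[mu]_x f (x, y) = 2%:E * (g \_ `]0%R, +oo[) y)%E.
Proof.
under eq_integral do rewrite fE.
rewrite patchE mem_setE/= in_itv/= andbT.
have [y0|y0] := ltP 0 y; last first.
  rewrite mule0; apply: integral0_eq => x _.
  by rewrite ifF// ltNge (le_trans y0)// powR_ge0.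
transitivity (\int[mu]_x ((cst (expR (- y))%:E \_
    `](- (y `^ rho^-1))%R, (y `^ rho^-1)%R[) x))%E.
  apply: eq_integral => x _; rewrite patchE mem_setE/= in_itv/= -ltr_norml.
  have -> : (`|x| `^ rho < y) = (`|x| < y `^ rho^-1).
    apply/idP/idP => h.
      rewrite -[ltLHS](@powRr1 _ `|x|)// -(mulfV (lt0r_neq0 rho_gt0)) powRrM.
      by rewrite gt0_ltr_powR// ?invr_gt0// nnegrE ?powR_ge0// ltW.
    rewrite -[ltRHS](@powRr1 _ y) ?ltW// -(mulVf (lt0r_neq0 rho_gt0)) powRrM.
    by rewrite gt0_ltr_powR// nnegrE ?powR_ge0.
  by case: ifP.
rewrite -integral_mkcond integral_cst//= lebesgue_measure_itv/= lte_fin.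
rewrite gtrN ?powR_gt0// -EFinB -!EFinM opprK; congr EFin.
by rewrite mulrC mulrA [2 * _]mulr_natl mulr2n.
Qed.

Let integrable_Gamma : mu.-integrable `]0, +oo[ g.
Proof.
have h0 : (0 : R) < 2^-1 by rewrite invr_gt0.
have mI : measurable (`]0, +oo[%classic : set (measurableTypeR R)) by [].
have := integrableS (@measurableT _ (measurableTypeR R)) mI (@subsetT _ _)
  (integrable_exponential_pdf h0).
move=> /(integrableZl mI 4%R); apply: le_integrable => //.
  apply/measurable_EFinP/measurable_funTS; apply: measurable_funM => //.
  by apply: measurableT_comp.
move=> x /=; rewrite in_itv/= andbT => x0; rewrite lee_fin.
rewrite !ger0_norm ?mulr_ge0 ?expR_ge0 ?powR_ge0//; last first.
  by rewrite exponential_pdf_ge0// ltW.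
rewrite (exponential_pdfE _ (ltW x0)) mulrA (_ : 4 * 2^-1 = 2); last first.
  by rewrite (_ : 4 = 2 * 2)%R ?mulfK// -natrM.
have -> : expR (- x) = (expR (2^-1 * x))^-1 * expR (- 2^-1 * x).
  by rewrite -expRN -expRD mulNr -opprD -mulrDl -[2^-1]mul1r -splitr mul1r.
rewrite mulrA ler_wpM2r ?expR_ge0// ler_pdivrMr ?expR_gt0//.
apply: (@le_trans _ _ (1 + x)); last first.
  apply: (@le_trans _ _ (2 * (1 + 2^-1 * x))); last first.
    by rewrite ler_wpM2l// expR_ge1Dx.
  by rewrite mulrDr mulr1 mulrA mulfV// mul1r lerD2r ler1n.
have p1 : rho^-1 <= 1 by rewrite invf_le1.
have [x1|x1] := leP x 1.
  apply: (@le_trans _ _ 1); last by rewrite lerDl ltW.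
  rewrite -[leRHS](congr1 (@^~ rho^-1) (powR1 R)).
  by apply: ge0_ler_powR; rewrite ?nnegrE ?invr_ge0 ?ler01//; exact: ltW.
by rewrite (le_trans (ler1_powR (ltW x1) p1))// lerDr.
Qed.

Let integral_bfun :
  (\int[mu]_x (bfun rho x)%:E = (2 * Gamma (1 + rho^-1))%:E)%E.
Proof.
transitivity (\int[mu]_x \int[mu]_y f (x, y))%E.
  by apply: eq_integral => x _; rewrite integral_y.
pose mu' : {sigma_finite_measure set (measurableTypeR R) -> \bar R} := mu.
transitivity (\int[mu']_y \int[mu']_x f (x, y))%E.
  exact: (@fubini_tonelli _ _ _ _ _ mu' mu' f mf f_ge0).
transitivity (\int[mu]_y (2%:E * (g \_ `]0%R, +oo[) y))%E.
  by apply: eq_integral => y _; rewrite -integral_x.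
rewrite ge0_integralZl_EFin//; first last.
- apply/(measurable_restrictT _ _).1 => //.
  exact: measurable_int integrable_Gamma.
- move=> y _; apply: erestrict_ge0 => z _.
  by rewrite lee_fin mulr_ge0 ?powR_ge0 ?expR_ge0.
rewrite -integral_mkcond EFinM; congr (_ * _)%E.
have e : 1 + rho^-1 - 1 = rho^-1 by rewrite addrC addKr.
rewrite /Gamma /Rintegral e [RHS]fineK//.
exact: integrable_fin_num integrable_Gamma.
Qed.

Let Gamma_gt0 : 0 < Gamma (1 + rho^-1).
Proof.
rewrite -(@pmulr_rgt0 _ 2)// -lte_fin -integral_bfun.
apply: (@lt_le_trans _ _ (\int[mu]_(x in `[0%R, 1%R]) (cst (expR (- 1))%:E) x)%E).
  rewrite integral_cst//= lebesgue_measure_itv/= lte_fin ltr01 sube0 mule1.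
  by rewrite lte_fin expR_gt0.
apply: (@le_trans _ _ (\int[mu]_(x in `[0%R, 1%R]) (bfun rho x)%:E)%E).
  apply: ge0_le_integral => //.
  - by move=> x _; rewrite lee_fin expR_ge0.
  - by apply/measurable_EFinP/measurable_funTS; exact: measurable_bfun.
  move=> x /=; rewrite in_itv/= => /andP[x0 x1].
  rewrite lee_fin ler_expR lerN2 ger0_norm//.
  rewrite -[leRHS](congr1 (@^~ rho) (powR1 R)).
  by apply: ge0_ler_powR; rewrite ?nnegrE ?ler01//; exact: ltW.
apply: ge0_subset_integral => //.
  by apply/measurable_EFinP; exact: measurable_bfun.
by move=> x _; rewrite lee_fin expR_ge0.
Qed.

Lemma integral_boltzmann_pdf : (\int[mu]_x (boltzmann_pdf rho x)%:E = 1)%E.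
Proof.
under eq_integral do rewrite /boltzmann_pdf EFinM.
rewrite ge0_integralZl_EFin//; first last.
- by rewrite invr_ge0 mulr_ge0// ltW.
- by apply/measurable_EFinP; exact: measurable_bfun.
by rewrite [X in (_ * X)%E]integral_bfun -EFinM mulVf// mulf_neq0// gt_eqF.
Qed.

Lemma boltzmann_pdf_ge0 x : 0 <= boltzmann_pdf rho x.
Proof.
by rewrite mulr_ge0 ?expR_ge0// invr_ge0 mulr_ge0// ltW.
Qed.

Lemma measurable_boltzmann_pdf : measurable_fun setT (boltzmann_pdf rho).
Proof. by apply: measurable_funM => //; exact: measurable_bfun. Qed.

End normalization.

(* The proof of 1 <= rho is an argument so that the probability structure below,
   which needs it, can be inferred. *)
Definition boltzmann_prob (rho : R) of 1 <= rho : set R -> \bar R :=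
  fun A => (\int[mu]_(x in A) (boltzmann_pdf rho x)%:E)%E.

Section boltzmann_prob.
Variables (rho : R) (rho_ge1 : 1 <= rho).
Local Notation boltzmann := (boltzmann_prob rho_ge1).

Let boltzmann0 : boltzmann set0 = 0%E.
Proof. by rewrite /boltzmann_prob integral_set0. Qed.

Let boltzmann_ge0 A : (0 <= boltzmann A)%E.
Proof.
by apply: integral_ge0 => x _; rewrite lee_fin boltzmann_pdf_ge0.
Qed.

Let boltzmann_sigma_additive : semi_sigma_additive boltzmann.
Proof.
move=> /= F mF tF mUF; rewrite /boltzmann_prob; apply: cvg_toP.
  apply: ereal_nondecreasing_is_cvgn => m n mn.
  apply: lee_sum_nneg_natr => // k _ _; apply: integral_ge0 => /= x Fkx.
  by rewrite lee_fin boltzmann_pdf_ge0.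
rewrite ge0_integral_bigcup//=.
- apply/measurable_funTS/measurableT_comp => //.
  exact: measurable_boltzmann_pdf.
- by move=> x _; rewrite lee_fin boltzmann_pdf_ge0.
Qed.

HB.instance Definition _ := isMeasure.Build _ _ _
  boltzmann boltzmann0 boltzmann_ge0 boltzmann_sigma_additive.

Let boltzmann_setT : boltzmann [set: R] = 1%E.
Proof. exact: integral_boltzmann_pdf. Qed.

HB.instance Definition _ :=
  @Measure_isProbability.Build _ _ R boltzmann boltzmann_setT.

End boltzmann_prob.

End boltzmann.

Section geometric_influence.
Context {R : realType}.

(* For r > 0, S + [-r, r] is a union of nondegenerate intervals, hence Borel. *)
Definition lower_minkowski (nu : set R -> \bar R) (S : set R) : \bar R :=
  limf_einf (fun r : R =>
    ((nu [set x + y | x in S & y in `[- r, r]]%R - nu S) * (r^-1)%:E)%E) 0^'+.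

Definition axis_section n (A : set (n.-tuple R)) (i : 'I_n) (x : n.-tuple R) :
    set R :=
  [set y | A [tuple (if j == i then y else tnth x j) | j < n]].

(* For Borel A the integrand is measurable only with respect to the completion
   of power_prob nu n.  As it is nonnegative, its integral is the supremum of the
   integrals of the measurable simple functions below it, which coincides with
   the integral with respect to the completed measure. *)
Definition geometric_influence (nu : probability R R) n
    (A : set (n.-tuple R)) (i : 'I_n) : \bar R :=
  (\int[power_prob nu n]_x lower_minkowski nu (axis_section A i x))%E.

End geometric_influence.

(* Main.v *)
(* Idea.  In dimension one, the lower Minkowski content of S is at least a
   multiple of M^(-1/rho) h(nu S), where h is the concave function
   h(s) = sum_(j = 1..M) min(s, 1 - s, 2^-j) and M is arbitrary.  It therefore
   suffices to bound below the largest of the integrals of h(nu(A_i^x)) by a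
   multiple of t (1 - t) M / n, for M of the order of log n.

   These integrals are Lipschitz in A, so that A can be replaced with a subset of
   a grid {0, .., 2^m - 1}^n made of quantile cells of nu.  As h is concave,
   compressing the set in each direction does not increase them, so that every
   fiber of the set can be taken to be an initial segment.  Write each coordinate
   in binary.  For an initial segment of density s, the influence of the j-th
   most significant digit is at most 2 min(s, 1 - s, 2^-j), and the digits after
   the M-th one carry a variance at most min(s, 1 - s, 2^-M) <= h(s) / M.  The
   argument of Kahn, Kalai and Linial, based on Bonami's inequality and applied
   to the first M digits of each coordinate, concludes. *)

(* Write L for log(1/min(s, 1 - s)). The isoperimetric bound is of order min(s, 1 - s) L^(1 -
   1/rho), whereas h(s) is of order min(s, 1 - s) min(M, L). Since M^(-1/rho) min(M, L) <= L^(1 -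
   1/rho), with equality at L = M, every M gives a valid lower bound, and M of order log n turns M /
   n into the factor M^(1 - 1/rho) / n of the theorem. The Minkowski content is not continuous for
   the distance nu(S + S') of the symmetric difference, so it is left at once for the integrals of
   h, which are. Compression cannot be avoided: for the set of even cells the last digit has maximal
   influence although its scale 2^-m is tiny, so only initial segments relate digit influences to h.
   It works because min(s, 1 - s, u) + s = min(s, u) + min(s, 1 - u) for u <= 1/2: the integral of s
   is the measure of the set, which compression preserves, and truncations min(s, u) are controlled
   by majorization. *)
From HB Require Import structures.
From mathcomp Require Import all_boot all_order all_algebra.
From mathcomp Require Import ring lra zify.
Set Implicit Arguments.
Unset Strict Implicit.
Unset Printing Implicit Defensive.
Import Order.TTheory GRing.Theory Num.Theory.
Local Open Scope ring_scope.

(** * Fourier analysis and hypercontractivity on the discrete cube *)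

Section mean.
Context {R : realFieldType} {T : finType}.
Implicit Types F G : T -> R.

Definition mean F : R := (\sum_x F x) / #|T|%:R.

Lemma eq_mean F G : F =1 G -> mean F = mean G.
Proof. by move=> FG; rewrite /mean; under eq_bigr do rewrite FG. Qed.

Lemma meanD F G : mean (fun x => F x + G x) = mean F + mean G.
Proof. by rewrite /mean big_split mulrDl. Qed.

Lemma meanZ (a : R) F : mean (fun x => a * F x) = a * mean F.
Proof. by rewrite /mean -mulr_sumr mulrA. Qed.

Lemma mean_sum (J : Type) (r : seq J) (P : pred J) (F : J -> T -> R) :
  mean (fun x => \sum_(j <- r | P j) F j x) = \sum_(j <- r | P j) mean (F j).
Proof. by rewrite /mean exchange_big /= mulr_suml. Qed.

Lemma le_mean F G : (forall x, F x <= G x) -> mean F <= mean G.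
Proof. by move=> FG; rewrite ler_wpM2r ?invr_ge0// ler_sum. Qed.

Lemma mean_ge0 F : (forall x, 0 <= F x) -> 0 <= mean F.
Proof. by move=> F0; rewrite mulr_ge0 ?invr_ge0// sumr_ge0. Qed.

Lemma mean_inj (s : T -> T) F : injective s -> mean (F \o s) = mean F.
Proof. by move=> inj_s; rewrite /mean [in RHS](reindex_inj inj_s). Qed.

Lemma mean_cst (a : R) : (0 < #|T|)%N -> mean (fun=> a) = a.
Proof.
by move=> T0; rewrite /mean sumr_const -(mulr_natr a) mulfK// pnatr_eq0 -lt0n.
Qed.

Lemma mean_CauchySchwarz F G :
  mean (fun x => F x * G x) ^+ 2 <=
  mean (fun x => F x ^+ 2) * mean (fun x => G x ^+ 2).
Proof.
rewrite /mean mulrACA exprMn -expr2 ler_wpM2r ?sqr_ge0//.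
rewrite -subr_ge0 -(@pmulr_rge0 _ 2)//.
(* Lagrange's identity. *)
suff -> : 2 * ((\sum_x F x ^+ 2) * (\sum_x G x ^+ 2) -
    (\sum_x F x * G x) ^+ 2) = \sum_x \sum_y (F x * G y - F y * G x) ^+ 2.
  by apply: sumr_ge0 => x _; apply: sumr_ge0 => y _; exact: sqr_ge0.
under [RHS]eq_bigr => x _.
  under eq_bigr => y _.
    rewrite (_ : _ ^+ 2 = F x ^+ 2 * G y ^+ 2 + G x ^+ 2 * F y ^+ 2
       - 2 * (F x * G x * (F y * G y))); last by ring.
    over.
  rewrite sumrB big_split/= -!mulr_sumr; over.
rewrite sumrB big_split/= -mulr_sumr -!mulr_suml; ring.
Qed.

End mean.

Section fourier.
Context {R : realFieldType} {I : finType}.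
Local Notation cube := {ffun I -> bool}.
Implicit Types (F G : cube -> R) (S U : {set I}) (x : cube).

Definition flip (j : I) x : cube := [ffun i => x i (+) (i == j)].

Lemma flipK j : involutive (flip j).
Proof. by move=> x; apply/ffunP => i; rewrite !ffunE -addbA addbb addbF. Qed.

(** The Walsh characters; [fcoef] gives the Fourier-Walsh coefficients. *)
Definition chi S x : R := \prod_(i in S) (-1) ^+ x i.

Lemma chi_flip S j x : chi S (flip j x) = (-1) ^+ (j \in S) * chi S x.
Proof.
rewrite /chi; under eq_bigr do rewrite ffunE signr_addb.
rewrite big_split/= mulrC; congr (_ * _); have [jS|jS] := boolP (j \in S).
  rewrite (bigD1 j)//= eqxx big1 ?mulr1// => i /andP[_ /negbTE ->].
  by rewrite expr0.
rewrite big1// => i iS; case: eqP => [ij|]; last by rewrite expr0.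
by rewrite -ij iS in jS.
Qed.

Lemma card_cube_gt0 : (0 < #|{: cube}|)%N.
Proof. by apply/card_gt0P; exists [ffun=> false]. Qed.

Lemma mean_chi_flip j F : (forall x, F (flip j x) = - F x) -> mean F = 0.
Proof.
move=> FN; suff : mean F = -1 * mean F by lra.
by rewrite -meanZ -(mean_inj F (inv_inj (flipK j))); apply: eq_mean => x /=;
  rewrite FN mulN1r.
Qed.

Definition fcoef F S : R := mean (fun x => F x * chi S x).

(** The sum over [S] factors over the coordinates, and the factor of a coordinate where [x] and [y]
    differ is zero. *)
Lemma chi_complete x y : \sum_S chi S x * chi S y = (x == y)%:R * #|{: cube}|%:R.
Proof.
transitivity (\prod_i ((-1) ^+ x i * (-1) ^+ y i + 1 : R)).
  rewrite bigA_distr; apply: eq_bigr => S _.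
  by rewrite /chi -big_split/= big_mkcond.
have [->|xy] := eqVneq x y.
  under eq_bigr do rewrite -expr2 sqrr_sign.
  by rewrite prodr_const mul1r card_ffun card_bool natrX.
have [j xyj] : exists j, x j != y j.
  apply/existsP; apply: contraT; rewrite negb_exists => /forallP h.
  by case/eqP: xy; apply/ffunP => j; have := h j; rewrite negbK => /eqP.
rewrite (bigD1 j)//= -signr_addb -negb_eqb xyj expr1 addNr mul0r.
by rewrite mul0r.
Qed.

Lemma fourier_inversion F x : F x = \sum_S fcoef F S * chi S x.
Proof.
transitivity (mean (fun y => F y * ((x == y)%:R * #|{: cube}|%:R))).
  rewrite /mean (bigD1 x)//= big1 => [|y /negbTE]; last first.
    by rewrite eq_sym => ->; rewrite mul0r mulr0.
  by rewrite eqxx mul1r addr0 mulfK// pnatr_eq0 -lt0n card_cube_gt0.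
under eq_mean do rewrite -chi_complete mulr_sumr.
rewrite mean_sum; apply: eq_bigr => S _.
by rewrite mulrC -meanZ; apply: eq_mean => y; ring.
Qed.

(** Plancherel against an arbitrary multiplier [c]: with [c := fcoef F] it gives [parseval], with
    the smoothed coefficients it gives the duality in [smoothed_energy_le]. *)
Lemma mean_fourier_mul (c : {set I} -> R) F :
  mean (fun x => F x * \sum_S c S * chi S x) = \sum_S c S * fcoef F S.
Proof.
under eq_mean do rewrite mulr_sumr.
rewrite mean_sum; apply: eq_bigr => S _.
by rewrite -meanZ; apply: eq_mean => x; ring.
Qed.

Lemma parseval F : mean (fun x => F x ^+ 2) = \sum_S fcoef F S ^+ 2.
Proof.
rewrite -mean_fourier_mul; apply: eq_mean => x.
by rewrite expr2 {2}fourier_inversion.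
Qed.

Lemma fcoef_flip F j S : fcoef (F \o flip j) S = (-1) ^+ (j \in S) * fcoef F S.
Proof.
rewrite /fcoef -(mean_inj _ (inv_inj (flipK j))) -meanZ.
by apply: eq_mean => x /=; rewrite flipK chi_flip; ring.
Qed.

Lemma fcoefB F G S : fcoef (fun x => F x - G x) S = fcoef F S - fcoef G S.
Proof.
rewrite /fcoef -mulN1r -meanZ -meanD.
by apply: eq_mean => x; ring.
Qed.

Lemma fcoef_invariant F j S : F \o flip j =1 F -> j \in S -> fcoef F S = 0.
Proof.
move=> Fj jS; have := fcoef_flip F j S; rewrite jS expr1 mulN1r.
rewrite {1}/fcoef; under eq_mean do rewrite Fj.
rewrite -/(fcoef F S); lra.
Qed.

Lemma fcoef0 F : fcoef F set0 = mean F.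
Proof. by apply: eq_mean => x; rewrite /chi big_set0 mulr1. Qed.

Lemma sum_subset_setU1 (F : {set I} -> R) U (i : I) : i \notin U ->
  \sum_(S : {set I} | S \subset i |: U) F S =
  \sum_(S : {set I} | S \subset U) F S + \sum_(S : {set I} | S \subset U) F (i |: S).
Proof.
move=> iU; rewrite (bigID (fun S : {set I} => i \notin S))/=; congr (_ + _).
  apply: eq_bigl => S; apply/andP/idP => [[SU iS]|SU].
    apply/fintype.subsetP => k kS; have := fintype.subsetP SU k kS.
    by rewrite in_setU1 => /orP[/eqP ki|//]; rewrite -ki kS in iS.
  split; last by apply: contra iU; exact: fintype.subsetP.
  by apply: fintype.subset_trans SU _; rewrite subsetU1.
rewrite (reindex_onto (fun S : {set I} => i |: S) (fun S => S :\ i))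
  => [|S]/=; last first.
  by rewrite negbK => /andP[_ /setD1K].
apply: eq_bigl => S; rewrite setU11 andbT; apply/andP/idP => [[SU /eqP SE]|SU].
  have iS : i \notin S by rewrite -SE !inE eqxx.
  apply/fintype.subsetP => k kS; have := fintype.subsetP SU k.
  rewrite !in_setU1 kS orbT => /(_ isT)/orP[/eqP ki|//].
  by rewrite -ki kS in iS.
rewrite setUS//= setU1K//; apply: contra iU; exact: fintype.subsetP.
Qed.

Lemma chi_setU1 i S x : i \notin S -> chi (i |: S) x = (-1) ^+ x i * chi S x.
Proof. by move=> iS; rewrite /chi big_setU1. Qed.

(* The fourth moment of the noise-smoothed function: splitting off one
   coordinate, the odd cross terms vanish. *)
Lemma bonami (c : {set I} -> R) :
  mean (fun x => (\sum_(S : {set I}) 3^-1 ^+ #|S| * c S * chi S x) ^+ 4) <=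
  (\sum_(S : {set I}) 3^-1 ^+ #|S| * c S ^+ 2) ^+ 2.
Proof.
pose P U (c : {set I} -> R) x :=
  \sum_(S : {set I} | S \subset U) 3^-1 ^+ #|S| * c S * chi S x.
pose A U (c : {set I} -> R) := \sum_(S : {set I} | S \subset U) 3^-1 ^+ #|S| * c S ^+ 2.
(* Restricting to subsets of [U] allows an induction on the size of [U]. With [c S] equal to
   3^(|S|/2) times a coefficient b_S, the claim is the usual bound of the fourth norm of the noise
   operator of parameter 1/sqrt 3 by the second norm; this normalization avoids square roots. *)
suff main U d : mean (fun x => P U d x ^+ 4) <= A U d ^+ 2.
  have := main setT c; rewrite /P /A.
  have sumT (F : {set I} -> R) : \sum_(S : {set I} | S \subset setT) F S = \sum_S F S.
    by apply: eq_bigl => S; rewrite finset.subsetT.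
  by rewrite sumT; under eq_mean do rewrite sumT.
have A_ge0 V e : 0 <= A V e.
  by apply: sumr_ge0 => S _; rewrite mulr_ge0 ?sqr_ge0// exprn_ge0// invr_ge0.
have [k] := ubnP #|U|; elim: k => [|k IH] in U d * => //; rewrite ltnS => Uk.
have [->|[i iU]] := set_0Vmem U.
  have sum0 (F : {set I} -> R) : \sum_(S : {set I} | S \subset set0) F S = F set0.
    by apply: big_pred1 => S; rewrite finset.subset0.
  rewrite /P /A sum0; under eq_mean do rewrite sum0 /chi big_set0 mulr1.
  by rewrite cards0 !mul1r mean_cst ?card_cube_gt0// -exprM.
pose V := U :\ i; pose d' S := d (i |: S).
have iV : i \notin V by rewrite !inE eqxx.
have Vk : (#|V| < k)%N by rewrite (cardsD1 i) iU in Uk.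
have UV : U = i |: V by rewrite setD1K.
have notin S : S \subset V -> i \notin S.
  by move=> SV; apply: contra iV; exact: fintype.subsetP.
have PE x : P U d x = P V d x + 3^-1 * ((-1) ^+ x i * P V d' x).
  rewrite /P UV sum_subset_setU1//; congr (_ + _).
  rewrite !mulr_sumr; apply: eq_bigr => S /notin iS.
  by rewrite chi_setU1// cardsU1 iS add1n exprS /d'; ring.
have AE : A U d = A V d + 3^-1 * A V d'.
  rewrite /A UV sum_subset_setU1//; congr (_ + _).
  rewrite !mulr_sumr; apply: eq_bigr => S /notin iS.
  by rewrite cardsU1 iS add1n exprS /d'; ring.
have Pflip e x : P V e (flip i x) = P V e x.
  by apply: eq_bigr => S /notin /negbTE iS; rewrite chi_flip iS mul1r.
pose p := P V d; pose q := P V d'.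
have sgnflip x : (-1) ^+ flip i x i = - (-1) ^+ x i :> R.
  by rewrite ffunE eqxx signr_addb expr1 mulrN1.
have -> : mean (fun x => P U d x ^+ 4) = mean (fun x => p x ^+ 4) +
    (6 / 9 * mean (fun x => p x ^+ 2 * q x ^+ 2) + 81^-1 * mean (fun x => q x ^+ 4)).
  rewrite -!meanZ -!meanD; apply/eqP; rewrite -subr_eq0 -mulN1r -meanZ -meanD.
  apply/eqP; apply: (@mean_chi_flip i) => x.
  rewrite !PE /p /q !Pflip sgnflip.
  by case: (x i); rewrite ?expr1 ?expr0; field.
pose pq := mean (fun x => p x ^+ 2 * q x ^+ 2).
pose p4 := mean (fun x => p x ^+ 4); pose q4 := mean (fun x => q x ^+ 4).
have pq2 : pq ^+ 2 <= p4 * q4.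
  apply: le_trans (mean_CauchySchwarz _ _) _.
  by rewrite /p4 /q4; under eq_mean do rewrite -exprM;
    under [X in _ * X <= _]eq_mean do rewrite -exprM.
have := IH V d Vk; have := IH V d' Vk.
rewrite -/p -/q -/pq -/p4 -/q4 AE.
move: (A_ge0 V d) (A_ge0 V d'); move: (A V d) (A V d') => a b a0 b0 qb pa.
have p40 : 0 <= p4 by rewrite /p4; apply: mean_ge0 => x; rewrite (exprM _ 2 2) sqr_ge0.
have pqab : pq <= a * b.
  have pq0 : 0 <= pq.
    by rewrite /pq; apply: mean_ge0 => x; rewrite mulr_ge0 ?sqr_ge0.
  have ab0 : 0 <= a * b by rewrite mulr_ge0.
  rewrite -(@ler_pXn2r _ 2) ?nnegrE//.
  rewrite (le_trans pq2)// exprMn ler_pM//.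
  by rewrite /q4; apply: mean_ge0 => x; rewrite (exprM _ 2 2) sqr_ge0.
(* The three means are at most a^2, ab and b^2, and a^2 + (6/9) ab + b^2/81 <= (a + b/3)^2: the
   factor 3^-1 makes the cross terms agree exactly. *)
nra.
Qed.

(* Duality: with u the smoothing of g, the sum is the mean of g * u, and two
   applications of Cauchy-Schwarz bound it by the fourth moment of u. *)
Lemma smoothed_energy_le g : (forall x, g x ^+ 3 = g x) ->
  (\sum_(S : {set I}) 3^-1 ^+ #|S| * fcoef g S ^+ 2) ^+ 2 <=
  mean (fun x => g x ^+ 2) ^+ 3.
Proof.
move=> g3; set W := \sum_S _; set e := mean (fun x => g x ^+ 2).
pose u x := \sum_(S : {set I}) 3^-1 ^+ #|S| * fcoef g S * chi S x.
have WE : W = mean (fun x => g x * (g x ^+ 2 * u x)).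
  under eq_mean do rewrite mulrA -exprS g3.
  rewrite mean_fourier_mul; apply: eq_bigr => S _; ring.
have W0 : 0 <= W.
  by apply: sumr_ge0 => S _; rewrite mulr_ge0 ?sqr_ge0// exprn_ge0// invr_ge0.
have e0 : 0 <= e by apply: mean_ge0 => x; exact: sqr_ge0.
have g4 x : g x ^+ 2 * g x ^+ 2 = g x ^+ 2.
  by rewrite -exprD (exprD _ 3 1) g3.
pose v := mean (fun x => g x ^+ 2 * u x ^+ 2).
have W2 : W ^+ 2 <= e * v.
  rewrite WE (le_trans (mean_CauchySchwarz _ _))// le_eqVlt; apply/orP; left.
  apply/eqP; congr (_ * _); apply: eq_mean => x.
  by rewrite exprMn expr2 g4.
have v2 : v ^+ 2 <= e * W ^+ 2.
  rewrite (le_trans (mean_CauchySchwarz _ _))// ler_pM//.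
  - by apply: mean_ge0 => x; exact: sqr_ge0.
  - by apply: mean_ge0 => x; exact: sqr_ge0.
  - by rewrite le_eqVlt; apply/orP; left; apply/eqP/eq_mean => x; rewrite expr2 g4.
  apply: le_trans (bonami _); rewrite le_eqVlt; apply/orP; left.
  by apply/eqP/eq_mean => x; rewrite -exprM.
(* Together [W2] and [v2] give W^4 <= e^3 W^2, which is divided by W^2. *)
have [->|Wn0] := eqVneq W 0; first by rewrite expr0n exprn_ge0.
have W2_gt0 : 0 < W ^+ 2 by rewrite exprn_gt0// lt_def Wn0.
rewrite -(ler_pM2l W2_gt0) -expr2.
have v0 : 0 <= v by apply: mean_ge0 => x; rewrite mulr_ge0 ?sqr_ge0.
apply: (@le_trans _ _ ((e * v) ^+ 2)).
  by rewrite ler_pXn2r// nnegrE; [exact: sqr_ge0|exact: mulr_ge0].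
rewrite exprMn mulrC (_ : W ^+ 2 * e ^+ 3 = e * W ^+ 2 * e ^+ 2); last by ring.
by rewrite ler_wpM2r ?sqr_ge0.
Qed.

Definition influence F j := mean (fun x => (F x - F (flip j x)) ^+ 2).

Lemma fcoef_diff F j S :
  fcoef (fun x => F x - F (flip j x)) S = 2 * (j \in S)%:R * fcoef F S.
Proof.
rewrite fcoefB (fcoef_flip F); case: (j \in S) => /=; rewrite ?expr1 ?expr0; ring.
Qed.

Lemma influenceE F j :
  influence F j = \sum_(S : {set I}) 4 * ((j \in S)%:R * fcoef F S ^+ 2).
Proof.
rewrite /influence parseval; apply: eq_bigr => S _; rewrite fcoef_diff.
by case: (j \in S) => /=; ring.
Qed.

Lemma influence_ge0 F j : 0 <= influence F j.
Proof. by apply: mean_ge0 => x; exact: sqr_ge0. Qed.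

(** The differences of a 0-1 function lie in {-1, 0, 1}, so [smoothed_energy_le] bounds the energy
    by the influence to the power 3/2. The parameter [s] stands for a square root of an upper bound
    of the influence. *)
Lemma smoothed_influence_le F j (s : R) : (forall x, F x ^+ 2 = F x) -> 0 <= s ->
  influence F j <= s ^+ 2 ->
  \sum_(S : {set I}) 4 * (3^-1 ^+ #|S| * (j \in S)%:R * fcoef F S ^+ 2)
    <= s * influence F j.
Proof.
move=> F01 s0 js.
have F_cases x : F x = 0 \/ F x = 1.
  have /eqP : F x * (F x - 1) = 0 by rewrite mulrBr mulr1 -expr2 F01 subrr.
  by rewrite mulf_eq0 subr_eq0 => /orP[] /eqP; [left|right].
have diff3 x : (F x - F (flip j x)) ^+ 3 = F x - F (flip j x).
  by case: (F_cases x) => ->; case: (F_cases (flip j x)) => ->; ring.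
have := smoothed_energy_le diff3; rewrite -/(influence F j).
rewrite (eq_bigr (fun S : {set I} =>
  4 * (3^-1 ^+ #|S| * (j \in S)%:R * fcoef F S ^+ 2))) => [|S _]; last first.
  by rewrite fcoef_diff; case: (j \in S) => /=; ring.
set W := \sum_(S : {set I}) _ => W2.
have q0 := influence_ge0 F j.
have W0 : 0 <= W.
  apply: sumr_ge0 => S _; rewrite mulr_ge0// mulr_ge0 ?sqr_ge0// mulr_ge0//.
  by rewrite exprn_ge0// invr_ge0.
have sq0 : 0 <= s * influence F j by rewrite mulr_ge0.
rewrite -(@ler_pXn2r _ 2) ?nnegrE// (le_trans W2)//.
rewrite [leRHS]exprMn [leLHS](exprS (influence F j) 2).
by rewrite ler_wpM2r ?sqr_ge0.
Qed.

(** The first summand is at least 1 for [d <= k], the second for [d > k]: this is the cut between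
    low and high levels. *)
Lemma level_weight (k d : nat) : (0 < d)%N ->
  1 <= 3 ^+ k * (3^-1 ^+ d * d%:R) + k.+1%:R^-1 * d%:R :> R.
Proof.
move=> d0; have t0 : 0 < 3 :> R by rewrite ltr0n.
have [dk|kd] := leqP d k.
  rewrite -[leLHS]addr0 lerD// ?mulr_ge0 ?invr_ge0// mulrA exprVn.
  rewrite -[leLHS]mulr1 ler_pM// ?ler1n//.
  by rewrite -expfB_cond ?gt_eqF// ?exprn_ege1 ?ler1n//; lia.
rewrite -[leLHS]add0r lerD//.
  by rewrite !mulr_ge0 ?exprn_ge0// ?invr_ge0 ltW.
by rewrite mulrC ler_pdivlMr ?ltr0n// mul1r ler_nat.
Qed.

(* Low levels are controlled by hypercontractivity, high levels by the total
   influence. *)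
Lemma sum_coarse_energy_le F (J : {set I}) (s : R) k :
  (forall x, F x ^+ 2 = F x) -> 0 <= s ->
  (forall j, j \in J -> influence F j <= s ^+ 2) ->
  \sum_(S : {set I} | (S \subset J) && (S != set0)) fcoef F S ^+ 2 <=
  (3 ^+ k * s + k.+1%:R^-1) * (\sum_(j in J) influence F j) / 4.
Proof.
move=> F01 s0 Js.
have cardS (S : {set I}) : S \subset J -> #|S|%:R = \sum_(j in J) (j \in S)%:R :> R.
  move=> SJ; rewrite -sum1_card natr_sum [RHS](bigID (mem S))/=.
  rewrite [X in _ = _ + X]big1 ?addr0 => [|j /andP[_ /negbTE ->]//].
  rewrite [RHS](eq_bigr (fun=> 1)) => [|j /andP[_ ->]//].
  apply: eq_bigl => j; rewrite andbC; case: (boolP (j \in S)) => //= jS.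
  by rewrite (fintype.subsetP SJ).
(* [E S] is the weight of [level_weight] at d = |S| times the squared coefficient, with |S| expanded
   as a sum over [J], so that exchanging the sums produces one term per digit. *)
pose E (S : {set I}) :=
  3 ^+ k * (\sum_(j in J) 3^-1 ^+ #|S| * (j \in S)%:R * fcoef F S ^+ 2)
  + k.+1%:R^-1 * (\sum_(j in J) (j \in S)%:R * fcoef F S ^+ 2).
have term_ge0 (c : R) (j : I) (S : {set I}) :
    0 <= c -> 0 <= c * (j \in S)%:R * fcoef F S ^+ 2.
  by move=> c0; rewrite mulr_ge0 ?sqr_ge0// mulr_ge0.
have t0 : 0 <= 3 :> R by rewrite ler0n.
have E0 S : 0 <= E S.
  apply: addr_ge0; apply: mulr_ge0; rewrite ?exprn_ge0 ?invr_ge0//.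
    by apply: sumr_ge0 => j _; apply: term_ge0; rewrite exprn_ge0 ?invr_ge0.
  by apply: sumr_ge0 => j _; rewrite -[X in X * _]mul1r term_ge0.
apply: (@le_trans _ _ (\sum_S E S)).
  rewrite [leRHS](bigID (fun S : {set I} => (S \subset J) && (S != set0)))/=.
  rewrite -[leLHS]addr0 lerD//; last by apply: sumr_ge0.
  apply: ler_sum => S /andP[SJ S0].
  rewrite -[leLHS]mul1r; apply: (@le_trans _ _ ((3 ^+ k * (3^-1 ^+ #|S| * #|S|%:R)
      + k.+1%:R^-1 * #|S|%:R) * fcoef F S ^+ 2)).
    by rewrite ler_wpM2r ?sqr_ge0// level_weight// card_gt0.
  rewrite /E cardS// mulrDl le_eqVlt; apply/orP; left; apply/eqP.
  congr (_ + _); last by rewrite -mulrA mulr_suml.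
  rewrite -!mulrA; congr (_ * _); rewrite mulr_suml mulr_sumr.
  by apply: eq_bigr => j _; rewrite mulrA.
rewrite big_split/= -!mulr_sumr exchange_big/=.
rewrite [X in _ + _ * X]exchange_big/= -mulrA mulrDl lerD//.
  rewrite -mulrA ler_wpM2l ?exprn_ge0// mulrA ler_pdivlMr ?ltr0n//.
  rewrite mulr_sumr mulr_suml; apply: ler_sum => j jJ.
  apply: le_trans (smoothed_influence_le F01 s0 (Js j jJ)).
  by rewrite mulrC -mulr_sumr.
rewrite ler_wpM2l ?invr_ge0// ler_pdivlMr ?ltr0n// mulr_suml.
by apply: ler_sum => j _; rewrite influenceE mulrC -mulr_sumr.
Qed.

(** The coefficients of [G] vanish on the sets that meet [K], where [F] and [F - G] therefore have
    the same coefficients. *)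
Lemma sum_fine_energy_le F G (K : {set I}) :
  (forall j, j \in K -> G \o flip j =1 G) ->
  \sum_(S : {set I} | S :&: K != set0) fcoef F S ^+ 2 <=
  mean (fun x => (F x - G x) ^+ 2).
Proof.
move=> GK; rewrite parseval [leRHS](bigID (fun S : {set I} => S :&: K != set0))/=.
rewrite -[leLHS]addr0 lerD//; last by apply: sumr_ge0 => S _; exact: sqr_ge0.
apply: ler_sum => S /set0Pn[j]; rewrite inE => /andP[jS jK].
by rewrite fcoefB (fcoef_invariant (GK j jK) jS) subr0.
Qed.

Lemma variance_fourier F : (forall x, F x ^+ 2 = F x) ->
  mean F * (1 - mean F) = \sum_(S : {set I} | S != set0) fcoef F S ^+ 2.
Proof.
move=> F01; have := parseval F; under eq_mean do rewrite F01.
rewrite (bigD1 set0)//= fcoef0; set r := \sum_(_ | _) _ => Fr.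
by rewrite mulrBr mulr1 {1}Fr expr2 addrAC subrr add0r.
Qed.

End fourier.

(** * Compression of subsets of a grid *)

Section grid.
Local Open Scope nat_scope.
Context {n N : nat}.
Local Notation grid := {ffun 'I_n -> 'I_N}.
Implicit Types (A : {set grid}) (x : grid) (i j : 'I_n) (y z : 'I_N).

Definition upd x i y : grid := [ffun k => if k == i then y else x k].

Lemma upd_eq x i y : upd x i y i = y.
Proof. by rewrite ffunE eqxx. Qed.

Lemma upd_neq x i j y : i != j -> upd x i y j = x j.
Proof. by rewrite ffunE eq_sym => /negbTE ->. Qed.

Lemma upd_upd x i y z : upd (upd x i y) i z = upd x i z.
Proof. by apply/ffunP => k; rewrite !ffunE; case: eqP. Qed.

Lemma upd_id x i : upd x i (x i) = x.
Proof. by apply/ffunP => k; rewrite ffunE; case: eqP => // ->. Qed.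

Lemma upd_comm x i j y z : i != j ->
  upd (upd x i y) j z = upd (upd x j z) i y.
Proof.
by move=> ij; apply/ffunP => k; rewrite !ffunE; do 2 case: eqP => //; move=> -> e;
  rewrite e eqxx in ij.
Qed.

Definition fiber_card A i x := #|[set y | upd x i y \in A]|.

Lemma fiber_card_upd A i x y : fiber_card A i (upd x i y) = fiber_card A i x.
Proof. by apply: eq_card => z; rewrite !inE upd_upd. Qed.

Lemma fiber_card_le A i x : fiber_card A i x <= N.
Proof. by rewrite -[leqRHS]card_ord max_card. Qed.

Lemma card_ord_ltn c : c <= N -> #|[set y : 'I_N | y < c]| = c.
Proof.
move=> cN; rewrite -sum1_card (eq_bigl (fun y : 'I_N => y < c)) => [|y].
  by rewrite (big_ord_narrow cN) sum1_card card_ord.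
by rewrite inE.
Qed.

Definition down_closed A i := forall x y, x \in A -> y <= x i -> upd x i y \in A.

Lemma down_closedE A i x : down_closed A i -> (x \in A) = (x i < fiber_card A i x).
Proof.
move=> dA; apply/idP/idP => [xA|].
  apply: (@leq_trans #|[set y : 'I_N | y < (x i).+1]|).
    by rewrite card_ord_ltn.
  by apply/subset_leq_card/subsetP => y; rewrite !inE ltnS; exact: dA.
apply: contraTT => xA; rewrite -leqNgt.
have <- : #|[set y : 'I_N | y < x i]| = x i by apply: card_ord_ltn; exact: ltnW.
apply/subset_leq_card/subsetP => y; rewrite !inE => yA.
rewrite ltnNge; apply: contra xA => xy.
have := dA (upd x i y) (x i) yA; rewrite upd_eq upd_upd upd_id; exact.
Qed.

Definition compress A i : {set grid} := [set x : grid | x i < fiber_card A i x].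

Lemma fiber_card_compress A i x : fiber_card (compress A i) i x = fiber_card A i x.
Proof.
rewrite -[RHS]card_ord_ltn ?fiber_card_le//; apply: eq_card => y.
by rewrite !inE upd_eq fiber_card_upd.
Qed.

Lemma down_closed_compress A i : down_closed (compress A i) i.
Proof.
move=> x y; rewrite !inE upd_eq fiber_card_upd => xA yx; exact: leq_ltn_trans xA.
Qed.

(** Lowering coordinate [j] can only enlarge the fibers in direction [i]. Hence compressing once in
    each direction suffices: a later compression does not undo an earlier one. *)
Lemma down_closed_compress_neq A i j : i != j ->
  down_closed A j -> down_closed (compress A i) j.
Proof.
move=> ij dA x y; rewrite !inE upd_neq 1?eq_sym// => xA yx.
apply: leq_trans xA _; apply/subset_leq_card/subsetP => z; rewrite !inE => zA.
by rewrite upd_comm 1?eq_sym//; apply: dA => //; rewrite upd_neq.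
Qed.

(** Exchanging [y] with coordinate [i] of [x] is an involution of the pairs. This turns a sum over
    the grid into a sum over the lines of direction [i]. *)
Lemma exchange_upd (T : Type) (idx : T) (op : Monoid.com_law idx)
    (F : grid -> T) i :
  \big[op/idx]_x \big[op/idx]_(y : 'I_N) F x =
  \big[op/idx]_x \big[op/idx]_(y : 'I_N) F (upd x i y).
Proof.
rewrite !pair_big/= (reindex_inj (h := fun p => (upd p.1 i p.2, p.1 i)))//=.
apply: (can_inj (g := fun p => (upd p.1 i p.2, p.1 i))) => -[x y]/=.
by rewrite upd_eq upd_upd upd_id.
Qed.

End grid.

Section majorization.
Local Open Scope nat_scope.
Context {N : nat}.
Implicit Types (B : rel 'I_N) (y z : 'I_N).

Lemma top_set (c : 'I_N -> nat) u : u <= N -> exists U : {set 'I_N},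
  #|U| = u /\ forall z z', z \in U -> z' \notin U -> c z' <= c z.
Proof.
elim: u => [_|u IH uN]; first by exists set0; split=> [|z z']; rewrite ?cards0 ?inE.
have [U [cU topU]] := IH (ltnW uN).
have [z0 z0U] : exists z0, z0 \in ~: U.
  by apply/card_gt0P; rewrite cardsCs setCK card_ord cU subn_gt0.
have [w wU wmax] := @arg_maxnP _ z0 (fun z => z \in ~: U) c z0U.
exists (w |: U); split; first by rewrite cardsU1 -in_setC wU cU.
move=> z z'; rewrite !inE negb_or => zU /andP[z'w z'U].
case/orP: zU => [/eqP ->|zU]; last exact: topU.
by apply: wmax; rewrite !inE.
Qed.

Lemma card_set_lt (A : pred 'I_N) : #|[set y | A y]| = \sum_y A y.
Proof.
rewrite -sum1_card big_mkcond/=; apply: eq_bigr => y _.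
by rewrite inE; case: (A y).
Qed.

(* The column counts of B, sorted decreasingly and transposed, dominate the row
   counts of B in the majorization order. *)
Lemma sum_minn_conjugate_le B u : u <= N ->
  \sum_(y < N) minn #|[set z : 'I_N | y < #|[set y' | B y' z]|]| u <=
  \sum_y minn #|[set z | B y z]| u.
Proof.
move=> uN; pose c z := #|[set y | B y z]|.
have [U [cU topU]] := top_set c uN.
have cN z : c z <= N by rewrite -[leqRHS]card_ord max_card.
(* The sum of the [u] largest column counts separates the two sides. A level set of [c] is nested
   with [U], up to ties, so it meets [U] in at least the minimum of the two sizes; a row meets [U]
   in at most that minimum. *)
apply: (@leq_trans (\sum_(z in U) c z)).
  rewrite [leqRHS](eq_bigr (fun z => \sum_(y < N) (y < c z))) => [|z _]; last first.
    by rewrite -(card_set_lt (fun y : 'I_N => y < c z)) card_ord_ltn.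
  rewrite exchange_big/=; apply: leq_sum => y _.
  rewrite -big_mkcondr/= sum1dep_card.
  have [LU|/subsetPn[z' z'L z'U]] := boolP ([set z : 'I_N | y < c z] \subset U).
    rewrite geq_min; apply/orP; left; apply/subset_leq_card/subsetP => z zL.
    by rewrite !inE (subsetP LU z zL); rewrite inE in zL.
  rewrite geq_min -[in X in _ || X]cU; apply/orP; right.
  apply/subset_leq_card/subsetP => z zU; rewrite !inE zU.
  by apply: leq_trans (topU _ _ zU z'U); rewrite inE in z'L.
rewrite [leqLHS](eq_bigr (fun z => \sum_y B y z)) => [|z _]; last exact: card_set_lt.
rewrite exchange_big/=; apply: leq_sum => y _.
rewrite -big_mkcondr/= sum1dep_card leq_min; apply/andP; split.
  by apply/subset_leq_card/subsetP => z; rewrite !inE => /andP[].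
by rewrite -cU; apply/subset_leq_card/subsetP => z; rewrite !inE => /andP[].
Qed.

End majorization.

Section compression.
Local Open Scope nat_scope.
Context {n N : nat}.
Local Notation grid := {ffun 'I_n -> 'I_N}.
Implicit Types (A : {set grid}) (x : grid) (i j : 'I_n).

Lemma sum_fiber_card A i : \sum_x fiber_card A i x = #|A| * N.
Proof.
transitivity (\sum_x \sum_(y : 'I_N) (x \in A : nat)).
  rewrite (exchange_upd _ _ i); apply: eq_bigr => x _.
  by rewrite /fiber_card card_set_lt.
under eq_bigr do rewrite sum_nat_const card_ord.
by rewrite -big_distrr/= mulnC -sum1_card [in RHS]big_mkcond.
Qed.

Lemma card_compress A i : 0 < N -> #|compress A i| = #|A|.
Proof.
move=> N0; apply/eqP; rewrite -(eqn_pmul2r N0) -2!(sum_fiber_card _ i).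
by apply/eqP/eq_bigr => x _; rewrite fiber_card_compress.
Qed.

(** For [i] distinct from [j], consider each plane of directions [i] and [j]. Compression pushes
    every column down, so that row [y] then consists of the columns of height more than [y]: its
    count is the conjugate of the column counts, as in [sum_minn_conjugate_le]. *)
Lemma sum_minn_compress_le A i j u : 0 < N -> u <= N ->
  \sum_x minn (fiber_card (compress A i) j x) u <= \sum_x minn (fiber_card A j x) u.
Proof.
move=> N0 uN; have [<-|ij] := eqVneq i j.
  by under eq_bigr do rewrite fiber_card_compress.
rewrite -(leq_pmul2r N0) !big_distrl/=.
have sumN (F : grid -> nat) :
    \sum_x F x * N = \sum_x \sum_(y : 'I_N) F (upd x i y).
  rewrite -(exchange_upd _ _ i); apply: eq_bigr => x _.
  by rewrite sum_nat_const card_ord mulnC.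
rewrite !sumN; apply: leq_sum => x _.
apply: leq_trans (sum_minn_conjugate_le (fun y z => upd (upd x i y) j z \in A) uN).
rewrite leq_eqVlt; apply/orP; left; apply/eqP/eq_bigr => y _; congr (minn _ u).
apply: eq_card => z; rewrite !inE upd_neq 1?eq_sym// upd_eq; congr (_ < _).
by apply: eq_card => y'; rewrite !inE (upd_comm x y z ij) upd_upd (upd_comm _ _ _ ij).
Qed.

Lemma exists_down_closed A : 0 < N -> exists B : {set grid},
  [/\ #|B| = #|A|, forall i, down_closed B i &
    forall i u, u <= N ->
      \sum_x minn (fiber_card B i x) u <= \sum_x minn (fiber_card A i x) u].
Proof.
move=> N0; suff [B [cB dB lB]] : exists B : {set grid},
  [/\ #|B| = #|A|, forall i, i \in enum 'I_n -> down_closed B i &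
    forall i u, u <= N ->
      \sum_x minn (fiber_card B i x) u <= \sum_x minn (fiber_card A i x) u].
  by exists B; split=> // i; apply: dB; rewrite mem_enum.
elim: (enum 'I_n) => [|j s [B [cB dB lB]]]; first by exists A.
exists (compress B j); split=> [|i|i u uN]; first by rewrite card_compress.
  rewrite inE; have [->|ij] := eqVneq i j.
    by move=> _; exact: down_closed_compress.
  by move=> /= si; apply: down_closed_compress_neq; [rewrite eq_sym|exact: dB].
by apply: leq_trans (lB i u uN); exact: sum_minn_compress_le.
Qed.

End compression.

(** * Binary digits and thresholds *)

Section binary.
Local Open Scope nat_scope.
Implicit Types (F : nat -> bool) (m w b : nat).

Definition binval F m := \sum_(b < m) F b * 2 ^ b.

Lemma ltn_binval F m : binval F m < 2 ^ m.
Proof.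
rewrite /binval; elim: m => [|m IH]; first by rewrite big_ord0.
rewrite big_ord_recr/= expnS mul2n -addnn.
case: (F m); rewrite ?mul1n ?mul0n; first by rewrite -addSn leq_add2r.
by rewrite addn0 (leq_trans IH)// leq_addl.
Qed.

Lemma binval_split F w m :
  binval F (w + m) = binval (fun b => F (w + b)) m * 2 ^ w + binval F w.
Proof.
rewrite /binval big_split_ord/= addnC; congr (_ + _).
by rewrite big_distrl/=; apply: eq_bigr => b _; rewrite expnD; lia.
Qed.

Lemma binval_div F w m : w <= m ->
  binval F m %/ 2 ^ w = binval (fun b => F (w + b)) (m - w).
Proof.
move=> wm; rewrite -{1}(subnKC wm) binval_split divnMDl ?expn_gt0//.
by rewrite divn_small ?addn0// ltn_binval.
Qed.

Lemma odd_binval_div F b m : b < m -> odd (binval F m %/ 2 ^ b) = F b.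
Proof.
move=> bm; rewrite binval_div 1?ltnW//.
case: (m - b) (subn_gt0 b m) => [|r]; first by rewrite bm.
move=> _; rewrite -[r.+1]add1n binval_split oddD oddM andbF addFb.
by rewrite /binval big_ord1 addn0 muln1; case: (F b).
Qed.

Lemma eq_binval F G m : (forall b, b < m -> F b = G b) -> binval F m = binval G m.
Proof. by move=> FG; apply: eq_bigr => b _; rewrite FG. Qed.

End binary.

Section bits.
Local Open Scope nat_scope.
Context {n m : nat}.
Local Notation cube := {ffun 'I_n * 'I_m -> bool}.
Local Notation grid := {ffun 'I_n -> 'I_(2 ^ m)}.

(* Bit b of coordinate i has weight 2^(m-b-1): bit 0 is the most significant. *)
Definition bit (x : cube) (i : 'I_n) (b : nat) : bool :=
  if insub b is Some b' then x (i, rev_ord b') else false.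

Definition grid_of (x : cube) : grid :=
  [ffun i => Ordinal (ltn_binval (bit x i) m)].

Lemma bit_ord x i (b : 'I_m) : bit x i b = x (i, rev_ord b).
Proof. by rewrite /bit valK. Qed.

Lemma grid_of_inj : injective grid_of.
Proof.
move=> x x' /ffunP xx'; apply/ffunP => -[i b].
have /(congr1 val)/= := xx' i; rewrite !ffunE/= => bb.
have := odd_binval_div (bit x i) (ltn_ord (rev_ord b)).
by rewrite bb odd_binval_div// !bit_ord rev_ordK => ->.
Qed.

Lemma grid_of_bij : bijective grid_of.
Proof.
apply: (inj_card_bij grid_of_inj).
by rewrite !card_ffun card_prod !card_ord card_bool -expnM mulnC.
Qed.

Lemma grid_of_flip_neq x i b k : i != k ->
  grid_of (flip (i, b) x) k = grid_of x k.
Proof.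
move=> ik; apply: val_inj; rewrite !ffunE/=; apply: eq_binval => c cm.
rewrite -[c]/(val (Ordinal cm)) !bit_ord ffunE xpair_eqE.
by rewrite [k == i]eq_sym (negbTE ik) addbF.
Qed.

(** The flipped digit has weight 2^(m-b-1), so the quotient by 2^w forgets it. *)
Lemma grid_of_flip_div x i (b : 'I_m) w : m - b <= w ->
  grid_of (flip (i, b) x) i %/ 2 ^ w = grid_of x i %/ 2 ^ w.
Proof.
move=> bw; rewrite !ffunE/=; have [wm|mw] := leqP w m; last first.
  by rewrite !divn_small// (leq_trans (ltn_binval _ _))// leq_exp2l// ltnW.
rewrite !binval_div//; apply: eq_binval => c cm.
have cm' : w + c < m by lia.
rewrite -[w + c]/(val (Ordinal cm')) !bit_ord ffunE xpair_eqE eqxx/=.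
case: eqP => [/(congr1 val)/= e|]; last by rewrite addbF.
have := ltn_ord b; lia.
Qed.

End bits.

Section threshold.
Local Open Scope nat_scope.
Context {N : nat}.

Lemma card_divn_eq D q : 0 < D -> #|[set y : 'I_N | y %/ D == q]| <= D.
Proof.
move=> D0; rewrite -[leqRHS]card_ord.
have lt_mod (y : 'I_N) : y %% D < D by rewrite ltn_mod.
rewrite -(card_in_imset (f := fun y => Ordinal (lt_mod y))) ?max_card// => y y'.
rewrite !inE => /eqP yq /eqP y'q [yy']; apply: val_inj => /=.
by rewrite (divn_eq y D) (divn_eq y' D) yq y'q yy'.
Qed.

(** At a crossing, one of [y] and [s y] lies below [c] and the other does not, which gives the first
    two bounds, with a factor 2 for the choice. Both lie in one block of length 2d, necessarily the
    block of [c], which gives the third. *)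
Lemma card_crossing_le (s : 'I_N -> 'I_N) c d : injective s -> c <= N -> 0 < d ->
  (forall y, s y %/ d.*2 = y %/ d.*2) ->
  #|[set y : 'I_N | (y < c) != (s y < c)]| <= 2 * minn (minn c (N - c)) d.
Proof.
move=> s_inj cN d0 sd; rewrite !minnMr !leq_min -andbA.
have clt : #|[set y : 'I_N | y < c]| = c by rewrite card_ord_ltn.
have cge : #|[set y : 'I_N | c <= y]| = N - c.
  rewrite -[N in RHS]card_ord -[in RHS]clt -cardsT -cardsDS ?subsetT//.
  by apply: eq_card => y; rewrite !inE andbT -leqNgt.
have union (B : {set 'I_N}) : #|B :|: s @^-1: B| <= 2 * #|B|.
  rewrite mul2n -addnn (leq_trans (leq_card_setU _ _))// leq_add2l.
  rewrite -(card_imset _ s_inj); apply/subset_leq_card/subsetP => _ /imsetP[y yB ->].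
  by rewrite inE in yB.
apply/and3P; split.
- rewrite -[in leqRHS]clt; apply: leq_trans (union _); apply/subset_leq_card/subsetP => y.
  by rewrite !inE; do 2 case: ltnP.
- rewrite -[in leqRHS]cge; apply: leq_trans (union _); apply/subset_leq_card/subsetP => y.
  by rewrite !inE; case: (ltnP y c); case: (ltnP (s y) c).
rewrite mul2n; have d20 : 0 < d.*2 by rewrite double_gt0.
apply: leq_trans (card_divn_eq (c %/ d.*2) d20); apply/subset_leq_card/subsetP => y.
rewrite !inE; case: ltnP => yc; case: ltnP => sc //= _; rewrite eqn_leq.
  by rewrite -{2}sd !leq_div2r// ltnW.
by rewrite -{1}sd !leq_div2r// ltnW.
Qed.

(* A threshold set is approximated by a union of blocks of length D, rounding
   towards the smaller of the set and its complement. *)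
Definition rounded_lt D c y :=
  if c.*2 <= N then y %/ D * D + D.-1 < c else y %/ D * D < c.

(** All the errors lie in the block of [c]. They also lie in the smaller of the threshold set and
    its complement, because the rounding only shrinks that side. *)
Lemma card_rounding_le D c : c <= N -> 0 < D ->
  #|[set y : 'I_N | (y < c) != rounded_lt D c y]| <= minn (minn c (N - c)) D.
Proof.
move=> cN D0.
have clt : #|[set y : 'I_N | y < c]| = c by rewrite card_ord_ltn.
have cge : #|[set y : 'I_N | c <= y]| = N - c.
  rewrite -[N in RHS]card_ord -[in RHS]clt -cardsT -cardsDS ?subsetT//.
  by apply: eq_card => y; rewrite !inE andbT -leqNgt.
have blk (y : 'I_N) : [/\ y %/ D * D <= y, y <= y %/ D * D + D.-1,
    (y %/ D * D) %/ D = y %/ D & (y %/ D * D + D.-1) %/ D = y %/ D].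
  have D1 : D.-1 %/ D = 0 by rewrite divn_small ?prednK.
  rewrite mulnK// divnMDl// D1 addn0.
  by have := divn_eq y D; have := ltn_pmod y D0; split=> //; lia.
rewrite /rounded_lt; have [cN2|cN2] := leqP c.*2 N.
  have -> : minn c (N - c) = c by lia.
  rewrite leq_min; apply/andP; split.
    rewrite -[leqRHS]clt; apply/subset_leq_card/subsetP => y; rewrite !inE.
    by have [_ yle _ _] := blk y; do 2 case: ltnP => //; lia.
  apply: leq_trans (card_divn_eq (c %/ D) D0); apply/subset_leq_card/subsetP => y.
  have [_ yle _ yD] := blk y; rewrite !inE; case: ltnP => yc; case: ltnP => sc //= _.
    by rewrite eqn_leq -{2}yD !leq_div2r// ltnW.
  lia.
have -> : minn c (N - c) = N - c by lia.
rewrite leq_min; apply/andP; split.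
  rewrite -[leqRHS]cge; apply/subset_leq_card/subsetP => y; rewrite !inE.
  by have [yle _ _ _] := blk y; do 2 case: ltnP => //; lia.
apply: leq_trans (card_divn_eq (c %/ D) D0); apply/subset_leq_card/subsetP => y.
have [yle _ yD _] := blk y; rewrite !inE; case: ltnP => yc; case: ltnP => sc //= _.
  lia.
by rewrite eqn_leq -{1}yD !leq_div2r// ltnW.
Qed.

End threshold.

(** * The influence bound on the grid *)

(* Up to a constant, s (1-s) min(M, log (1/(s (1-s)))). *)
Definition tent {R : realFieldType} (M : nat) (s : R) : R :=
  \sum_(b < M) Num.min (Num.min s (1 - s)) (2^-1 ^+ b.+1).

Section discrete.
Context {R : realFieldType} {n m : nat}.
Local Notation N := (2 ^ m)%N.
Local Notation grid := {ffun 'I_n -> 'I_N}.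
Local Notation cube := {ffun 'I_n * 'I_m -> bool}.
Implicit Types (A : {set grid}) (z : grid) (i : 'I_n).

Let N_gt0 : (0 < N)%N. Proof. by rewrite expn_gt0. Qed.
Let NR_gt0 : 0 < N%:R :> R. Proof. by rewrite ltr0n. Qed.

Definition small_side c d : nat := minn (minn c (N - c)) d.

Definition scale_mass A i d : R :=
  mean (fun z => (small_side (fiber_card A i z) d)%:R / N%:R).

Lemma mean_upd (F : grid -> R) i :
  mean F = mean (fun z => (\sum_y F (upd z i y)) / N%:R).
Proof.
rewrite /mean -mulr_suml -exchange_upd; congr (_ / _).
under eq_bigr do rewrite sumr_const card_ord -mulr_natr.
by rewrite -mulr_suml mulfK// gt_eqF.
Qed.

Lemma mean_grid_of (F : grid -> R) :
  mean (fun x : cube => F (grid_of x)) = mean F.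
Proof.
rewrite /mean (bij_eq_card grid_of_bij); congr (_ / _).
rewrite [RHS](reindex (@grid_of n m))//.
exact/onW_bij/grid_of_bij.
Qed.

(** This reduces the two-sided truncation to one-sided ones. The extra term [c] sums to a multiple
    of the cardinal of the set, which compression preserves. *)
Lemma small_sideE c d : (c <= N)%N -> (d.*2 <= N)%N ->
  (small_side c d + c = minn c d + minn c (N - d))%N.
Proof. rewrite /small_side; lia. Qed.

Lemma tent_div (c M : nat) : (c <= N)%N -> (M <= m)%N ->
  tent M (c%:R / N%:R) =
  \sum_(b < M) (small_side c (2 ^ (m - b.+1)))%:R / N%:R :> R.
Proof.
move=> cN Mm; apply: eq_bigr => b _.
have bm : (b.+1 <= m)%N by apply: leq_trans Mm.
have V0 : 0 <= (N%:R : R)^-1 by rewrite invr_ge0 ltW.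
rewrite /small_side -!minEnat !natr_min !(minr_pMl _ _ V0) natrB// mulrBl divff ?gt_eqF//.
congr (Num.min _ _).
have -> : (2 ^ m = 2 ^ (m - b.+1) * 2 ^ b.+1)%N by rewrite -expnD subnK.
rewrite natrM invfM mulrA divff ?mul1r ?pnatr_eq0 -?lt0n ?expn_gt0//.
by rewrite natrX exprVn.
Qed.

Section down_closed.
Variable A : {set grid}.
Hypothesis dA : forall i, down_closed A i.

Let F (x : cube) : R := (grid_of x \in A)%:R.

Let in_upd z i y : (upd z i y \in A) = (y < fiber_card A i z)%N.
Proof. by rewrite (down_closedE _ (@dA i)) upd_eq fiber_card_upd. Qed.

Let sqr_diff (b b' : bool) : (b%:R - b'%:R) ^+ 2 = (b != b')%:R :> R.
Proof. by case: b; case: b'; rewrite /=; ring. Qed.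

Lemma influence_down_closed_le i (b : 'I_m) :
  influence F (i, b) <= 2 * scale_mass A i (2 ^ (m - b.+1)).
Proof.
have [g gK Kg] := @grid_of_bij n m.
(* The digit flip read on the grid. On a line of direction [i] it is a permutation that preserves
   the blocks of length 2^(m-b), to which [card_crossing_le] applies. *)
pose sg z := grid_of (flip (i, b) (g z)).
have sgK : involutive sg by move=> z; rewrite /sg gK flipK Kg.
have sg_neq z k : i != k -> sg z k = z k.
  by move=> ik; rewrite /sg grid_of_flip_neq// Kg.
have sg_div z : (sg z i %/ (2 ^ (m - b.+1)).*2 = z i %/ (2 ^ (m - b.+1)).*2)%N.
  have -> : ((2 ^ (m - b.+1)).*2 = 2 ^ (m - b))%N.
    by rewrite -mul2n -expnS; congr expn; have := ltn_ord b; lia.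
  by rewrite /sg grid_of_flip_div// Kg.
have -> : influence F (i, b) =
    mean (fun z : grid => ((z \in A)%:R - (sg z \in A)%:R) ^+ 2 : R).
  by rewrite -mean_grid_of; apply: eq_mean => x; rewrite /sg gK.
rewrite (mean_upd _ i) -meanZ; apply: le_mean => z.
rewrite mulrA ler_pM2r ?invr_gt0// -natrM.
pose s y := sg (upd z i y) i.
have sgE y : sg (upd z i y) = upd z i (s y).
  apply/ffunP => k; have [<-|ik] := eqVneq i k; first by rewrite upd_eq.
  by rewrite sg_neq// !upd_neq.
have s_inj : injective s.
  move=> y y' ss; have := sgE y; rewrite ss -sgE => /(inv_inj sgK).
  by move=> /ffunP/(_ i); rewrite !upd_eq.
under eq_bigr do rewrite sgE !in_upd sqr_diff.
rewrite -natr_sum -(card_set_lt (fun y => (y < _) != (s y < _))%N) ler_nat.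
apply: card_crossing_le => //; first exact: fiber_card_le.
  by rewrite expn_gt0.
by move=> y; rewrite /s sg_div upd_eq.
Qed.

Lemma rounding_error_le M i : (M <= m)%N ->
  let G x : R := (rounded_lt (N := N) (2 ^ (m - M)) (fiber_card A i (grid_of x))
    (grid_of x i))%:R in
  mean (fun x => (F x - G x) ^+ 2) <= scale_mass A i (2 ^ (m - M)).
Proof.
move=> Mm /=; pose D := (2 ^ (m - M))%N.
rewrite (mean_grid_of (fun z => ((z \in A)%:R -
  (rounded_lt (N := N) D (fiber_card A i z) (z i))%:R) ^+ 2)).
rewrite (mean_upd _ i); apply: le_mean => z; rewrite ler_pM2r ?invr_gt0//.
under eq_bigr do rewrite in_upd upd_eq fiber_card_upd sqr_diff.
rewrite -natr_sum -(card_set_lt (fun y : 'I_N => (y < _) != rounded_lt _ _ _)%N).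
by rewrite ler_nat card_rounding_le ?fiber_card_le// expn_gt0.
Qed.

Lemma discrete_down_closed M k (a s : R) : (0 < M <= m)%N ->
  (forall i, mean (fun z => tent M ((fiber_card A i z)%:R / N%:R)) <= a) ->
  0 <= s -> 2 * a <= s ^+ 2 ->
  let t := mean (fun z => (z \in A)%:R : R) in
  t * (1 - t) <= n%:R * a / M%:R + (3 ^+ k * s + k.+1%:R^-1) * (n%:R * a / 2).
Proof.
move=> /andP[M0 Mm] tent_le s0 as2 /=; set t := mean _.
have F01 x : F x ^+ 2 = F x by rewrite /F; case: (_ \in _) => /=; ring.
have tE : t = mean F by rewrite /t -mean_grid_of.
have massE i : mean (fun z => tent M ((fiber_card A i z)%:R / N%:R)) =
    \sum_(b < M) scale_mass A i (2 ^ (m - b.+1)).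
  by rewrite -mean_sum; apply: eq_mean => z; rewrite tent_div// fiber_card_le.
have mass_ge0 i d : 0 <= scale_mass A i d.
  by apply: mean_ge0 => z; rewrite mulr_ge0 ?invr_ge0.
have mass_le i (b : nat) : (b < M)%N -> scale_mass A i (2 ^ (m - b.+1)) <= a.
  move=> bM; apply: le_trans (tent_le i); rewrite massE (bigD1 (Ordinal bM))//=.
  by rewrite lerDl sumr_ge0.
(* [J] holds the first [M] digits of every coordinate, and [K i] the remaining digits of coordinate
   [i]. *)
pose J := [set j : 'I_n * 'I_m | (j.2 < M)%N].
pose K i := [set j : 'I_n * 'I_m | (j.1 == i) && (M <= j.2)%N].
rewrite tE variance_fourier//.
(* A set of digits not contained in [J] meets some [K i]. The energy of these sets gives the term n
   a / M, that of the subsets of [J] the other term. *)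
rewrite (bigID (fun S : {set _} => S \subset J))/= addrC lerD//.
  apply: (@le_trans _ _ (\sum_(i < n) \sum_(S : {set _} | S :&: K i != set0)
      fcoef F S ^+ 2)).
    rewrite (exchange_big_dep predT)//= big_mkcond/=.
    apply: ler_sum => S _; case: ifP => [/andP[_ /subsetPn[[i b] jS]]|_]; last first.
      by apply: sumr_ge0 => i _; exact: sqr_ge0.
    rewrite inE/= -leqNgt => Mb; rewrite /=.
    have iS : S :&: K i != set0.
      by apply/set0Pn; exists (i, b); rewrite !inE jS/= eqxx.
    by rewrite (bigD1 i)//= lerDl sumr_ge0// => ? _; exact: sqr_ge0.
  rewrite -mulrA mulr_natl -[in leRHS](card_ord n) -sumr_const; apply: ler_sum => i _.
  pose G x : R := (rounded_lt (N := N) (2 ^ (m - M)) (fiber_card A i (grid_of x))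
    (grid_of x i))%:R.
  apply: (@le_trans _ _ (mean (fun x => (F x - G x) ^+ 2))); last first.
    apply: le_trans (rounding_error_le i Mm) _.
    (* The mass at scale 2^(m-M) is at most each of the [M] masses whose sum is bounded by [a],
       hence at most a / M. *)
    rewrite ler_pdivlMr ?ltr0n// (le_trans _ (tent_le i))// massE.
    rewrite mulr_natr -[X in _ *+ X](card_ord M) -sumr_const; apply: ler_sum => b _.
    apply: le_mean => z; rewrite ler_pM2r ?invr_gt0// ler_nat /small_side.
    rewrite leq_min geq_minl/= (leq_trans (geq_minr _ _))// leq_exp2l//.
    by have := ltn_ord b; lia.
  apply: sum_fine_energy_le => -[i' b]; rewrite inE/= => /andP[/eqP -> Mb] x.
  rewrite /= /G; congr (_%:R).
  have bm := ltn_ord b.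
  have -> : fiber_card A i (grid_of (flip (i, b) x)) = fiber_card A i (grid_of x).
    apply: eq_card => y; rewrite !inE.
    suff -> : upd (grid_of (flip (i, b) x)) i y = upd (grid_of x) i y by [].
    apply/ffunP => k'; have [<-|ik] := eqVneq i k'; first by rewrite !upd_eq.
    by rewrite !upd_neq// grid_of_flip_neq.
  by rewrite /rounded_lt grid_of_flip_div//; lia.
rewrite (eq_bigl _ _ (fun S => andbC _ _)).
have infl_le j : j \in J -> influence F j <= s ^+ 2.
  case: j => i b; rewrite inE/= => bM.
  apply: le_trans (influence_down_closed_le _ _) _.
  by apply: le_trans as2; rewrite ler_pM2l//; exact: mass_le.
apply: le_trans (sum_coarse_energy_le k F01 s0 infl_le) _.
rewrite -mulrA ler_wpM2l//; first by rewrite addr_ge0 ?invr_ge0// mulr_ge0// exprn_ge0.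
rewrite ler_pdivrMr ?ltr0n// (_ : n%:R * a / 2 * 4 = 2 * (n%:R * a)); last by field.
apply: (@le_trans _ _ (\sum_(j in J) 2 * scale_mass A j.1 (2 ^ (m - j.2.+1)))).
  by apply: ler_sum => -[i b] _; exact: influence_down_closed_le.
rewrite -mulr_sumr ler_pM2l// mulr_natl -[in leRHS](card_ord n) -sumr_const.
rewrite (eq_bigl (fun j : 'I_n * 'I_m => true && (j.2 < M)%N)) => [|j];
  last by rewrite inE.
rewrite -(pair_big predT (fun b : 'I_m => b < M)%N
  (fun i (b : 'I_m) => scale_mass A i (2 ^ (m - b.+1))))/=.
apply: ler_sum => i _; apply: le_trans (tent_le i); rewrite massE.
by rewrite (big_ord_narrow Mm).
Qed.

End down_closed.

Theorem discrete_influence_bound A M k (a s : R) : (0 < M <= m)%N ->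
  (forall i, mean (fun z => tent M ((fiber_card A i z)%:R / N%:R)) <= a) ->
  0 <= s -> 2 * a <= s ^+ 2 ->
  let t := mean (fun z => (z \in A)%:R : R) in
  t * (1 - t) <= n%:R * a / M%:R + (3 ^+ k * s + k.+1%:R^-1) * (n%:R * a / 2).
Proof.
move=> M0m tent_le s0 as2 /=; have /andP[_ Mm] := M0m.
have [B [cB dB lB]] := exists_down_closed A N_gt0.
have meanE (C : {set grid}) :
    mean (fun z => (z \in C)%:R : R) = #|C|%:R / #|{: grid}|%:R.
  by rewrite /mean -natr_sum -sum1_card [in RHS]big_mkcond.
rewrite meanE -cB -meanE; apply: discrete_down_closed => // i.
apply: le_trans (tent_le i).
rewrite /mean ler_pM2r ?invr_gt0 ?ltr0n; last first.
  by apply/card_gt0P; exists [ffun=> Ordinal N_gt0].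
under eq_bigr do rewrite tent_div ?fiber_card_le//.
under [leRHS]eq_bigr do rewrite tent_div ?fiber_card_le//.
rewrite exchange_big [leRHS]exchange_big/=; apply: ler_sum => b _.
rewrite -!mulr_suml ler_pM2r ?invr_gt0// -!natr_sum ler_nat.
have d2 : ((2 ^ (m - b.+1)).*2 <= N)%N.
  rewrite -mul2n -expnS leq_exp2l//; have := ltn_ord b; lia.
have d1 : (2 ^ (m - b.+1) <= N)%N by lia.
(* Since [B] and [A] have the same cardinal, comparing the small sides amounts to comparing
   truncations at d and at N - d, which is [lB]. *)
have sumE (C : {set grid}) : (\sum_z small_side (fiber_card C i z) (2 ^ (m - b.+1)) +
    #|C| * N = \sum_z minn (fiber_card C i z) (2 ^ (m - b.+1)) +
    \sum_z minn (fiber_card C i z) (N - 2 ^ (m - b.+1)))%N.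
  rewrite -(sum_fiber_card C i) -!big_split/=; apply: eq_bigr => z _.
  by rewrite small_sideE ?fiber_card_le.
by rewrite -(leq_add2r (#|B| * N)) [in leqRHS]cB !sumE leq_add ?lB// leq_subr.
Qed.

End discrete.

Require Import Defs.
From mathcomp Require Import all_classical all_reals all_analysis.
From mathcomp Require Import measurable_realfun.
Import numFieldNormedType.Exports.
Local Open Scope classical_set_scope.
Local Open Scope ring_scope.

(** * One-dimensional isoperimetry for the Boltzmann measure *)

(* Both sides are suprema of integrals of simple functions. *)
Lemma le_lower_integral d (T : measurableType d) (R : realType)
    (mu : {measure set T -> \bar R}) (D : set T) (f g : T -> \bar R) :
  (forall x, D x -> 0 <= f x)%E -> (forall x, D x -> f x <= g x)%E ->
  (\int[mu]_(x in D) f x <= \int[mu]_(x in D) g x)%E.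
Proof.
move=> f0 fg; have g0 x : D x -> (0 <= g x)%E.
  by move=> Dx; exact: le_trans (f0 x Dx) (fg x Dx).
rewrite !ge0_integralE//; apply: le_ereal_sup => _ [h hf <-]; exists h => // x.
apply: le_trans (hf x) _; rewrite !patchE; case: ifPn => // xD.
by apply: fg; rewrite inE in xD.
Qed.

Section neighbourhood.
Context {R : realType}.
Implicit Types (S : set R) (r x a b : R).

Definition thicken S r : set R := [set x + y | x in S & y in `[- r, r]].

Lemma thickenP S r z : thicken S r z <-> exists2 x, S x & `|z - x| <= r.
Proof.
split=> [[x Sx [y]]|[x Sx zx]].
  by rewrite /= in_itv/= -ler_norml => yr <-; exists x => //; rewrite addrC addKr.
exists x; first exact: Sx.
exists (z - x); last by rewrite addrC subrK.
by rewrite /= in_itv/= -ler_norml.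
Qed.

Lemma sub_thicken S r : 0 <= r -> S `<=` thicken S r.
Proof. by move=> r0 x Sx; apply/thickenP; exists x => //; rewrite subrr normr0. Qed.

(** If some [y] of the interval escapes the thickening, take for [w] the supremum of the points of
    [S] in [[x, y]]: points of [S] accumulate at [w] or attain it, none lies between [w] and [y],
    and [y] is at distance at least [r] from [w]. *)
Lemma thicken_gap_right S x b r : S x -> 0 < r ->
  `]x, b[ `<=` thicken S r \/
  exists w, [/\ x <= w, w + r <= b & `]w, w + r[ `<=` thicken S r `\` S].
Proof.
move=> Sx r0; have [sub|nsub] := pselect (`]x, b[ `<=` thicken S r); first by left.
right; have [y [/andP[xy yb] ySr]] : exists y, x < y < b /\ ~ thicken S r y.
  apply: contra_notP nsub => h y /=; rewrite in_itv/= => yxb.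
  by apply: contrapT => yS; apply: h; exists y.
pose E := S `&` `[x, y].
have Ele e : E e -> e < y - r.
  move=> [Se]; rewrite /= in_itv/= => /andP[xe ey]; rewrite ltNge; apply/negP => er.
  by apply: ySr; apply/thickenP; exists e => //; rewrite ger0_norm; lra.
have Ex : E x by split=> //=; rewrite in_itv/= lexx ltW.
have supE : has_sup E by split; [exists x|exists (y - r) => e /Ele /ltW].
exists (sup E); split.
- exact: ub_le_sup supE.2 _ Ex.
- suff : sup E <= y - r by lra.
  by apply: ge_sup; [exists x|move=> e /Ele /ltW].
move=> t /=; rewrite in_itv/= => /andP[Et tE].
have supEy : sup E <= y - r by apply: ge_sup; [exists x|move=> e /Ele /ltW].
split.
  have [e Ee te] := @sup_adherent _ E (r - (t - sup E)) ltac:(lra) supE.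
  have eE : e <= sup E by exact: ub_le_sup supE.2 _ Ee.
  by apply/thickenP; exists e; [exact: Ee.1|rewrite ger0_norm; lra].
move=> St; have : E t.
  split=> //=; rewrite in_itv/=.
  have := ub_le_sup supE.2 Ex; lra.
by move=> /(ub_le_sup supE.2); lra.
Qed.

Lemma thicken_opp S r : thicken (-%R @` S) r = -%R @` thicken S r.
Proof.
apply/seteqP; split=> [z /thickenP[_ [x Sx <-]]|_ [z /thickenP[x Sx zx] <-]].
  rewrite opprK => zx; exists (- z); rewrite ?opprK//; apply/thickenP.
  by exists x => //; rewrite -opprD normrN.
by apply/thickenP; exists (- x); [exists x|rewrite opprK addrC distrC].
Qed.

Lemma thicken_gap_left S x a r : S x -> 0 < r ->
  `]a, x[ `<=` thicken S r \/
  exists w, [/\ w <= x, a <= w - r & `]w - r, w[ `<=` thicken S r `\` S].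
Proof.
move=> Sx r0; have : (-%R @` S) (- x) by exists x.
move=> /(@thicken_gap_right _ _ (- a) r) /(_ r0); rewrite thicken_opp.
move=> [sub|[w [xw wa sub]]]; [left|right].
  move=> t /=; rewrite in_itv/= => /andP[at_ tx].
  have /sub : [set` `]- x, - a[] (- t) by rewrite /= in_itv/= !ltrN2 at_ tx.
  by move=> [u Su /oppr_inj <-].
exists (- w); split; [lra|lra|move=> t /=; rewrite in_itv/= => tw].
have /sub : [set` `]w, (w + r)[] (- t) by rewrite /= in_itv/=; lra.
move=> [[u Su /oppr_inj <-] nS]; split=> // Su'; apply: nS; by exists u.
Qed.

End neighbourhood.

Section isoperimetry.
Context {R : realType} (rho : R) (rho_gt1 : 1 < rho).
Local Notation phi := (boltzmann_pdf rho).
Local Notation nu := (boltzmann_prob (ltW rho_gt1)).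
Local Notation mu := (@lebesgue_measure R).

Let Z : R := (2 * Gamma (1 + rho^-1))^-1.

Let phi0 : phi 0 = Z.
Proof.
rewrite /boltzmann_pdf -/Z normr0 powR0 ?oppr0 ?expR0 ?mulr1//.
by rewrite gt_eqF// (lt_trans ltr01).
Qed.

Let Z_gt0 : 0 < Z.
Proof.
rewrite lt_def -{2}phi0 boltzmann_pdf_ge0 ?ltW// andbT; apply/eqP => Z0.
have := integral_boltzmann_pdf (ltW rho_gt1).
under eq_integral do rewrite /boltzmann_pdf -/Z Z0 mul0r.
by rewrite integral0 => /eqP; rewrite eq_sym onee_eq0.
Qed.

Lemma boltzmann_pdfE :
  exists2 z : R, 0 < z & forall x, phi x = z * expR (- `|x| `^ rho).
Proof. by exists Z. Qed.

Lemma boltzmann_pdf_gt0 x : 0 < phi x.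
Proof. by rewrite mulr_gt0 ?expR_gt0. Qed.

Lemma boltzmann_pdf_le (x y : R) : `|x| <= `|y| -> phi y <= phi x.
Proof.
move=> xy; rewrite ler_wpM2l ?(ltW Z_gt0)// ler_expR lerN2.
by rewrite ge0_ler_powR ?nnegrE// (le_trans ler01)// ltW.
Qed.

(** Stated for arbitrary sets because it is applied to thickenings, whose measurability is not
    established here. *)
Lemma le_boltzmann (A B : set R) : A `<=` B -> (nu A <= nu B)%E.
Proof.
move=> AB; rewrite /boltzmann_prob integral_mkcond [leRHS]integral_mkcond.
apply: le_lower_integral => x _.
  by apply: erestrict_ge0 => y _; rewrite lee_fin ltW ?boltzmann_pdf_gt0.
apply: restrict_lee => // y _; by rewrite lee_fin ltW ?boltzmann_pdf_gt0.
Qed.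

Lemma boltzmann_itv_ge (a b c : R) : a <= b -> - c <= a -> b <= c ->
  ((phi c * (b - a))%:E <= nu `]a, b[)%E.
Proof.
move=> ab ca bc; rewrite EFinM.
apply: (@le_trans _ _ (\int[mu]_(x in `]a, b[) cst (phi c)%:E x)%E).
  rewrite integral_cst//= lebesgue_measure_itv/= lte_fin.
  by move: ab; rewrite le_eqVlt => /predU1P[->|->]; rewrite ?ltxx ?subrr ?mule0 ?EFinB.
apply: le_lower_integral => x; rewrite /= in_itv/= => /andP[ax xb].
  by rewrite lee_fin ltW ?boltzmann_pdf_gt0.
rewrite lee_fin boltzmann_pdf_le// [leRHS]ger0_norm; last lra.
by rewrite ler_norml; lra.
Qed.

(* A point of S and a part of positive measure of the complement of S, both at
   distance at most b of the origin, are separated by a gap through which S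
   grows at speed at least phi b. *)
Lemma lower_minkowski_ge (S : set R) (b : R) : measurable S ->
  (nu [set x | (b <= `|x|)%R] < nu S)%E -> (nu [set x | (b <= `|x|)%R] < nu (~` S))%E ->
  ((phi b)%:E <= lower_minkowski nu S)%E.
Proof.
move=> mS bS bSc; pose B := `]- b, b[%classic : set R.
have mB : measurable B by exact: measurable_itv.
have BcE : ~` B = [set x | b <= `|x|].
  by rewrite /B; apply/seteqP; split=> x /=; rewrite in_itv/= -ltr_norml leNgt => /negP.
have meet (C : set R) : measurable C -> (nu (~` B) < nu C)%E -> (0 < nu (C `&` B))%E.
  move=> mC; rewrite lt0e measure_ge0 andbT; apply: contraTneq => CB0.
  have -> : nu C = (nu (C `\` B) + nu (C `&` B))%E by exact: measureDI.
  rewrite -leNgt CB0 adde0.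
  by apply: le_boltzmann => x [].
rewrite -BcE in bS bSc.
have [x [Sx]] : S `&` B !=set0.
  by apply/set0P/eqP => SB0; have := meet S mS bS; rewrite SB0 measure0 ltxx.
rewrite /B/= in_itv/= => /andP[bx xb].
have mSc : measurable (~` S) by exact: measurableC.
pose Ur := `]x, b[ `\` S; pose Ul := `]- b, x[ `\` S.
have mUr : measurable Ur by apply: measurableD.
have mUl : measurable Ul by apply: measurableD.
have mixed : (0 < nu Ur)%E \/ (0 < nu Ul)%E.
  apply/orP; rewrite !lt0e !measure_ge0 !andbT -negb_and.
  apply/negP => /andP[/eqP r0 /eqP l0].
  have := meet _ mSc bSc; apply/negP; rewrite -leNgt.
  apply: (@le_trans _ _ (nu (Ur `|` Ul))); last first.
    have U2 : (nu (Ur `|` Ul) <= nu Ur + nu Ul)%E by exact: measureU2.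
    by rewrite r0 l0 adde0 in U2.
  apply: le_boltzmann => y [/= Sy]; rewrite /B/= in_itv/= => /andP[by_ yb].
  have [xy|yx|xy] := ltgtP x y; last by rewrite -xy in Sy.
    by left; split=> //=; rewrite in_itv/= xy yb.
  by right; split=> //=; rewrite in_itv/= by_ yx.
have b0 : 0 < b by lra.
have grow r (C : set R) : 0 < r -> measurable C -> C `<=` thicken S r `\` S ->
    ((phi b * r)%:E <= nu C)%E -> ((phi b)%:E <= (nu (thicken S r) - nu S) * r^-1%:E)%E.
  move=> r0 mC CS Cr; have finS : nu S \is a fin_num by exact: fin_num_measure.
  rewrite lee_pdivlMr// leeBrDr//.
  rewrite -EFinM; apply: le_trans (leeD2r _ Cr) _.
  have <- : nu (C `|` S) = (nu C + nu S)%E.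
    by apply: measureU => //; apply/seteqP; split=> // y [/CS[]].
  apply: le_boltzmann => y [/CS[]//|Sy]; exact: sub_thicken (ltW r0) _ Sy.
have [r0 r0_gt0 hr] : exists2 r0, 0 < r0 & forall r, 0 < r < r0 ->
    ((phi b)%:E <= (nu (thicken S r) - nu S) * r^-1%:E)%E.
  have itv_grow r w : 0 < r -> - b <= w -> w + r <= b ->
      `]w, w + r[ `<=` thicken S r `\` S ->
      ((phi b)%:E <= (nu (thicken S r) - nu S) * r^-1%:E)%E.
    move=> r0 bw wb sub; apply: (grow r `]w, w + r[%classic) => //.
    apply: le_trans (boltzmann_itv_ge _ bw wb); last by lra.
    by rewrite (_ : w + r - w = r)//; lra.
  (* This covers the case without a gap: the thickening then absorbs all of [U], whose measure does
     not depend on [r] and exceeds [phi b * r] for small [r]. *)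
  have big_grow (U : set R) : measurable U -> (0 < nu U)%E ->
      exists2 r0, 0 < r0 & forall r, r < r0 -> ((phi b * r)%:E <= nu U)%E.
    move=> mU U0; have finU : nu U \is a fin_num by exact: fin_num_measure.
    have U0' : 0 < fine (nu U) by rewrite -lte_fin fineK.
    exists (fine (nu U) / phi b); first by rewrite divr_gt0 ?boltzmann_pdf_gt0.
    move=> r; rewrite ltr_pdivlMr ?boltzmann_pdf_gt0// => /ltW.
    by rewrite -[nu U]fineK// lee_fin mulrC.
  case: mixed => U0.
    have [r0 r0_gt0 hr0] := big_grow _ mUr U0; exists r0 => // r /andP[r_gt0 rr0].
    have [sub|[w [xw wb sub]]] := thicken_gap_right b Sx r_gt0; last first.
      by apply: itv_grow sub => //; lra.
    apply: (grow r Ur) => //; last exact: hr0.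
    by move=> y [/sub].
  have [r0 r0_gt0 hr0] := big_grow _ mUl U0; exists r0 => // r /andP[r_gt0 rr0].
  have [sub|[w [wx bw sub]]] := thicken_gap_left (- b) Sx r_gt0; last first.
    have e : w = w - r + r by rewrite subrK.
    by rewrite {2}e in sub; apply: itv_grow sub => //; lra.
  apply: (grow r Ul) => //; last exact: hr0.
  by move=> y [/sub].
rewrite /lower_minkowski limf_einfE.
apply: (@le_trans _ _ (ereal_inf ((fun r : R =>
    ((nu (thicken S r) - nu S) * r^-1%:E)%E) @` `]0, r0[))).
  apply: le_ereal_inf_tmp => _ [r /= rr0 <-]; apply: hr.
  by move: rr0; rewrite in_itv.
apply: ereal_sup_ubound; exists `]0, r0[%classic => //.
rewrite /=. near=> r.
rewrite /= in_itv/=; apply/andP; split; near: r.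
  exact: nbhs_right_gt.
exact: nbhs_right_lt.
Unshelve. all: end_near.
Qed.

End isoperimetry.

Section exponential_tail.
Context {R : realType}.
Local Notation mu := (@lebesgue_measure R).

Lemma integral_expR_tail (beta b : R) : 0 < beta ->
  (\int[mu]_(x in `[b, +oo[) (expR (- (beta * x)))%:E =
   (expR (- (beta * b)) / beta)%:E)%E.
Proof.
move=> beta0; pose F (x : R) := - beta^-1 * expR (- (beta * x)).
have dF (x : R) : is_derive x 1 F (expR (- (beta * x))).
  pose lin (x : R) := - (beta * x).
  have dlin : is_derive x 1 lin (- beta).
    by apply: is_derive_eq; rewrite -[beta *: 1]/(beta * 1) mulr1.
  have dexp := @is_derive1_comp _ expR lin x _ _ (is_derive_expR (lin x)) dlin.
  apply: (@is_derive_eq _ _ _ _ _ _ _ _ (is_deriveZ (- beta^-1) dexp)).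
  by rewrite -[_ *: _]/(_ * _) mulrCA mulrNN mulVf ?mulr1// gt_eqF.
have cE : continuous (fun x : R => expR (- (beta * x))).
  move=> x; apply: continuous_comp; last exact: continuous_expR.
  by apply: cvgN; apply: cvgMl_tmp; exact: cvg_id.
rewrite (@ge0_continuous_FTC2y _ _ F _ 0)//.
- by rewrite sub0e -EFinN /F mulNr opprK mulrC.
- exact: continuous_subspaceT.
- rewrite -[X in _ --> X](mulr0 (- beta^-1)); apply: cvgMl_tmp.
  apply: (@cvg_comp _ _ _ (fun x : R => beta * x) (fun x => expR (- x)) _ +oo%R).
    by apply: gt0_cvgMry => //; exact: cvg_id.
  exact: cvgr_expR.
- by apply: cvg_at_right_filter; apply: cvgMl_tmp; exact: cE.
- by move=> x _; rewrite derive1E; apply: derive_val.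
Qed.

Lemma integral_even_left (f : R -> \bar R) (b : R) : measurable_fun [set: R] f ->
  (forall x, 0 <= f x)%E -> (forall x, f (- x) = f x) ->
  (\int[mu]_(x in `]-oo, (- b)%R]) f x = \int[mu]_(x in `[b, +oo[) f x)%E.
Proof.
move=> mf f0 fN; under eq_integral do rewrite -fN.
rewrite (_ : `]-oo, (- b)%R]%classic =
    (-%R : _ -> measurableTypeR R) @^-1` `[b, +oo[); last first.
  by rewrite opp_preimage_itvbndy.
rewrite -ge0_integral_pushforward//=; last exact: measurable_funS mf.
by apply: eq_measure_integral => //= A mA AS; exact/lebesgue_measureN.
Qed.

End exponential_tail.

Section tail.
Context {R : realType} (rho : R) (rho_gt1 : 1 < rho).
Local Notation phi := (boltzmann_pdf rho).
Local Notation nu := (boltzmann_prob (ltW rho_gt1)).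
Local Notation mu := (@lebesgue_measure R).

(** For x >= b one has x^rho >= b^(rho-1) x, with equality at b, so each of the two tails is
    dominated by an exponential one. *)
Lemma boltzmann_tail_le (b : R) : 0 < b ->
  (nu [set x | (b <= `|x|)%R] <= (2 * phi b / b `^ (rho - 1))%:E)%E.
Proof.
move=> b0; have mphi := measurable_boltzmann_pdf rho.
have phi_ge0 x : 0 <= phi x by apply: boltzmann_pdf_ge0; exact: ltW.
have beta0 : 0 < b `^ (rho - 1) by exact: powR_gt0.
have right : (\int[mu]_(x in `[b, +oo[) (phi x)%:E <=
    (phi b / b `^ (rho - 1))%:E)%E.
  rewrite /boltzmann_pdf; set Z := _^-1.
  have Z0 : 0 <= Z.
    by have := phi_ge0 0; rewrite /boltzmann_pdf -/Z pmulr_lge0 ?expR_gt0.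
  apply: (@le_trans _ _ (\int[mu]_(x in `[b, +oo[)
      (Z%:E * (expR (- (b `^ (rho - 1) * x)))%:E))%E).
    apply: le_lower_integral => x; rewrite /= in_itv/= andbT => bx.
      by rewrite lee_fin mulr_ge0 ?expR_ge0.
    have x0 : 0 <= x by rewrite (le_trans (ltW b0)).
    have rho0 : 0 < rho by exact: lt_trans ltr01 rho_gt1.
    rewrite -EFinM lee_fin ler_wpM2l// ler_expR lerN2 ger0_norm//.
    rewrite -(mulr_powRB1 x0 rho0) mulrC ler_wpM2l//.
    by rewrite ge0_ler_powR ?nnegrE ?(ltW b0)// subr_ge0 ltW.
  rewrite ge0_integralZl_EFin//; last first.
    by apply/measurable_EFinP/measurable_funTS; apply: measurableT_comp => //;
      apply: measurableT_comp => //; apply: measurable_funM.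
  rewrite integral_expR_tail// -EFinM lee_fin mulrA.
  have rho0 : 0 < rho by exact: lt_trans ltr01 rho_gt1.
  by rewrite [b `^ _ * b]mulrC (mulr_powRB1 (ltW b0) rho0) (ger0_norm (ltW b0)).
have -> : [set x | b <= `|x|] = `]-oo, (- b)%R] `|` `[b, +oo[.
  apply/seteqP; split=> x /=; rewrite !in_itv/= andbT.
    by rewrite ler_normr => /orP[bx|bx]; [right|left; lra].
  by rewrite ler_normr => -[xb|->//]; apply/orP; right; lra.
rewrite /boltzmann_prob ge0_integral_setU//; first last.
- apply/disj_setPS => x [] /=; rewrite !in_itv/= andbT; lra.
- by move=> x _; rewrite lee_fin.
- by apply/measurable_funTS/measurable_EFinP.
rewrite (integral_even_left b (f := EFin \o phi)) => [||x|x]/=.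
- by rewrite -mulrA mulr_natl mulr2n EFinD leeD.
- exact/measurable_EFinP.
- by rewrite lee_fin.
- by rewrite /boltzmann_pdf normrN.
Qed.

End tail.

(** * Comparison of [tent] with the Minkowski content *)

Section tent.
Context {R : realFieldType}.
Implicit Types (s : R) (M k : nat).

Lemma tent_ge0 M s : 0 <= s <= 1 -> 0 <= tent M s.
Proof.
move=> s01; apply: sumr_ge0 => b _.
by rewrite !le_min exprn_ge0 ?invr_ge0// subr_ge0 andbT.
Qed.

Lemma tent_le_mul M s : tent M s <= M%:R * Num.min s (1 - s).
Proof.
rewrite mulr_natl -[X in _ *+ X](card_ord M) -sumr_const; apply: ler_sum => b _.
by rewrite ge_min lexx.
Qed.

Lemma tent_le_split M k s : 0 <= s <= 1 ->
  tent M s <= k%:R * Num.min s (1 - s) + 2^-1 ^+ k.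
Proof.
move=> s01; have side0 : 0 <= Num.min s (1 - s) by rewrite le_min subr_ge0.
have V0 (j : nat) : 0 <= 2^-1 ^+ j :> R by rewrite exprn_ge0 ?invr_ge0.
have [Mk|/ltnW kM] := leqP M k.
  rewrite -[leLHS]addr0 lerD// (le_trans (tent_le_mul _ _))// ler_wpM2r//.
  by rewrite ler_nat.
suff le_sub r : tent (k + r) s <=
    k%:R * Num.min s (1 - s) + 2^-1 ^+ k - 2^-1 ^+ (k + r).
  have := le_sub (M - k)%N; rewrite subnKC// => /le_trans; apply.
  by rewrite gerDl oppr_le0.
elim: r => [|r IH]; first by rewrite addn0 addrK tent_le_mul.
rewrite addnS /tent big_ord_recr/=.
have : Num.min (Num.min s (1 - s)) (2^-1 ^+ (k + r).+1) <= 2^-1 ^+ (k + r).+1.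
  by rewrite ge_min lexx orbT.
by move: IH; rewrite /tent exprS; lra.
Qed.

End tent.

Section isoperimetry.
Context {R : realType} (rho : R) (rho_gt1 : 1 < rho).
Local Notation phi := (boltzmann_pdf rho).
Local Notation nu := (boltzmann_prob (ltW rho_gt1)).

Lemma fine_boltzmann01 (S : set R) : measurable S -> 0 <= fine (nu S) <= 1.
Proof.
move=> mS; rewrite fine_ge0 ?measure_ge0//=.
by rewrite -lee_fin fineK ?fin_num_measure// probability_le1.
Qed.

Lemma lower_minkowski_ge0 (S : set R) : (0 <= lower_minkowski nu S)%E.
Proof.
rewrite /lower_minkowski limf_einfE.
apply: (@le_trans _ _ (ereal_inf ((fun r : R =>
    ((nu (thicken S r) - nu S) * r^-1%:E)%E) @` `]0, 1[))).
  apply: le_ereal_inf_tmp => _ [r /= r01 <-]; move: r01; rewrite in_itv/= => /andP[r0 _].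
  rewrite mule_ge0// ?lee_fin ?invr_ge0 ?(ltW r0)//.
  have finS : nu S \is a fin_num.
    rewrite ge0_fin_numE ?measure_ge0//; apply: (@le_lt_trans _ _ (nu setT)).
      exact: le_boltzmann.
    by rewrite [ltLHS]probability_setT ltry.
  rewrite sube_ge0 ?finS//.
  by apply: le_boltzmann; apply: sub_thicken; exact: ltW.
apply: ereal_sup_ubound; exists `]0, 1[%classic => //.
near=> r; rewrite /= in_itv/=; apply/andP; split; near: r.
  exact: nbhs_right_gt.
exact: nbhs_right_lt.
Unshelve. all: end_near.
Qed.

(** Contrapositive of [lower_minkowski_ge]: a content below [phi b] forces [S] or its complement to
    have at most the measure of the tail. *)
Lemma small_side_le_tail (S : set R) (v b : R) : measurable S -> 0 < b ->
  (lower_minkowski nu S <= v%:E)%E -> v < phi b ->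
  Num.min (fine (nu S)) (1 - fine (nu S)) <= 2 * phi b / b `^ (rho - 1).
Proof.
move=> mS b0 Sv vb; set T := 2 * _ / _; rewrite ge_min -!lee_fin EFinB.
rewrite fineK ?fin_num_measure//.
have <- : (nu (~` S) = 1 - nu S)%E by exact: probability_setC.
have tail := boltzmann_tail_le rho_gt1 b0.
apply/orP; have [bS|Sb] := ltP (nu [set x | b <= `|x|]) (nu S); last first.
  by left; exact: le_trans tail.
right; have [bSc|Scb] := ltP (nu [set x | b <= `|x|]) (nu (~` S)); last first.
  exact: le_trans tail.
have := le_trans (lower_minkowski_ge mS bS bSc) Sv.
by rewrite lee_fin leNgt vb.
Qed.

Lemma expR1_half_le2 : expR (2^-1 : R) <= 2.
Proof.
rewrite -[leLHS]invrK -expRN -[leRHS]invrK lef_pV2 ?posrE ?expR_gt0 ?invr_gt0//.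
by apply: le_trans (expR_ge1Dx _); lra.
Qed.

Lemma tent_le_lower_minkowski : exists2 K : R, 0 < K &
  forall M (S : set R) v, (0 < M)%N -> measurable S -> 0 < v ->
    (lower_minkowski nu S <= v%:E)%E ->
    tent M (fine (nu S)) <= K * M%:R `^ rho^-1 * v.
Proof.
have rho0 : 0 < rho by exact: lt_trans ltr01 rho_gt1.
have [Z Z0 phiE] := boltzmann_pdfE rho_gt1.
(* 12 = 3 * 4 comes from k <= 3 l and from the 4 in [side]. The other term serves when [v] is large,
   where [tent] is at most 1, and absorbs the remainder 2^-k otherwise. *)
pose K := 12 + 2 * expR 1 / Z.
have K12 : 12 <= K.
  by rewrite lerDl divr_ge0 ?(ltW Z0)// mulr_ge0 ?expR_ge0.
have K0 : 0 < K by lra.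
exists K => // M S v M0 mS v0 Sv.
have s01 := fine_boltzmann01 mS; set s := fine (nu S) in s01 *.
have M1 : 1 <= M%:R :> R by rewrite ler1n.
have r0 : 0 <= rho^-1 by rewrite invr_ge0 ltW.
have Mp1 : 1 <= M%:R `^ rho^-1.
  by rewrite -[leLHS](powRr0 M%:R) ler_powR.
have [small|large] := leP (2 * v * expR 1) Z; last first.
  apply: le_trans (tent_le_split M 0 s01) _; rewrite mul0r add0r expr0.
  apply: (@le_trans _ _ (K * v)); last by rewrite ler_wpM2r ?ler_peMr// ltW.
  have : 1 <= 2 * expR 1 / Z * v.
    by rewrite mulrAC ler_pdivlMr// mul1r mulrAC ltW.
  by rewrite /K mulrDl; lra.
(* Chosen so that [phi] equals 2v, which exceeds v, at the point l^(1/rho). *)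
pose l := ln (Z / (2 * v)).
have Zv0 : 0 < Z / (2 * v) by rewrite divr_gt0// mulr_gt0.
have l1 : 1 <= l.
  rewrite -ler_expR lnK ?posrE// ler_pdivlMr ?mulr_gt0//.
  by rewrite mulrC.
have l0 : 0 < l by exact: lt_le_trans l1.
pose b := l `^ rho^-1; have b0 : 0 < b by exact: powR_gt0.
have phib : phi b = 2 * v.
  rewrite phiE ger0_norm ?(ltW b0)// /b -powRrM mulVf ?gt_eqF// powRr1 ?(ltW l0)//.
  by rewrite expRN lnK ?posrE// invf_div mulrCA mulfV ?mulr1// gt_eqF.
have bp : b `^ (rho - 1) = l / l `^ rho^-1.
  rewrite /b -powRrM mulrBr mulr1 mulVf ?gt_eqF// powRB ?powRr1 ?(ltW l0)//.
  by rewrite (gt_eqF l0) implybT.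
have side : Num.min s (1 - s) <= 4 * v * (l `^ rho^-1 / l).
  have := small_side_le_tail mS b0 Sv; rewrite phib bp invf_div => /(_ _)/le_trans.
  by apply; [lra|rewrite !mulrA; lra].
have side0 : 0 <= Num.min s (1 - s) by rewrite le_min subr_ge0.
have lr0 : 0 <= l `^ rho^-1 by exact: powR_ge0.
(* If M <= l, all [M] summands are bounded by [side], and x^(1/rho - 1) is decreasing. If l < M, the
   sum is cut at some [k] of order l. *)
have [Ml|lM] := leP M%:R l.
  apply: le_trans (tent_le_mul _ _) _.
  apply: (@le_trans _ _ (M%:R * (4 * v * (M%:R `^ rho^-1 / M%:R)))).
    rewrite ler_wpM2l// (le_trans side)// ler_wpM2l ?mulr_ge0 ?(ltW v0)//.
    have powBE (x : R) : 0 < x -> x `^ rho^-1 / x = (x `^ (1 - rho^-1))^-1.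
      by move=> x0; rewrite powRB ?(gt_eqF x0) ?implybT// powRr1 ?(ltW x0)// invf_div.
    have M0' : 0 < M%:R :> R by rewrite ltr0n.
    rewrite !powBE// lef_pV2 ?posrE ?powR_gt0// ge0_ler_powR ?nnegrE ?(ltW l0)//.
    by rewrite subr_ge0 invf_le1// ltW.
  rewrite (_ : M%:R * _ = 4 * M%:R `^ rho^-1 * v); last first.
    by field; rewrite pnatr_eq0 -lt0n.
  by rewrite ler_wpM2r ?(ltW v0)// ler_wpM2r ?powR_ge0//; lra.
(* As e^(1/2) <= 2, the bound k >= 2 l ensures 2^-k <= e^-l = 2v / Z. An integer exists in the range
   because l >= 1. *)
have [k /andP[k2l kl]] : exists k : nat, 2 * l <= k%:R <= 3 * l.
  exists (Num.trunc (2 * l)).+1.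
  have /truncn_itv/andP[kl lk] : 0 <= 2 * l by rewrite mulr_ge0// ltW.
  by rewrite (ltW lk)/= -natr1; lra.
apply: le_trans (tent_le_split M k s01) _.
have lM' : l `^ rho^-1 <= M%:R `^ rho^-1.
  by rewrite ge0_ler_powR ?nnegrE// ltW.
have two_k : 2^-1 ^+ k <= 2 * v / Z.
  rewrite exprVn -[leRHS]invf_div lef_pV2 ?posrE ?exprn_gt0//.
  rewrite -[leLHS]lnK ?posrE// -/l.
  apply: (@le_trans _ _ (expR (2^-1 * k%:R))); first by rewrite ler_expR; lra.
  by rewrite expRM_natr lerXn2r ?nnegrE ?expR_ge0 ?expR1_half_le2.
have main : k%:R * Num.min s (1 - s) <= 12 * v * l `^ rho^-1.
  apply: (@le_trans _ _ (3 * l * (4 * v * (l `^ rho^-1 / l)))).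
    by rewrite ler_pM.
  by rewrite le_eqVlt; apply/orP; left; apply/eqP; field; rewrite gt_eqF.
have e1 : 1 <= expR 1 :> R by rewrite -[leLHS]expR0 ler_expR.
have vZ : 2 * v / Z <= 2 * expR 1 / Z * v.
  rewrite mulrAC ler_wpM2r ?(ltW v0)// ler_wpM2r ?invr_ge0 ?(ltW Z0)//.
  by rewrite ler_peMr.
apply: (@le_trans _ _ (12 * v * M%:R `^ rho^-1 + 2 * expR 1 / Z * v * M%:R `^ rho^-1)).
  apply: lerD.
    by apply: le_trans main _; rewrite ler_wpM2l// mulr_ge0// ltW.
  apply: le_trans (le_trans two_k vZ) _; rewrite ler_peMr//.
  by rewrite !mulr_ge0 ?expR_ge0 ?invr_ge0// ltW.
by rewrite /K le_eqVlt; apply/orP; left; apply/eqP; ring.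
Qed.

Lemma boltzmann_isoperimetry : exists2 K : R, 0 < K &
  forall M (S : set R), (0 < M)%N -> measurable S ->
    ((tent M (fine (nu S)) / (K * M%:R `^ rho^-1))%:E <= lower_minkowski nu S)%E.
Proof.
have [K K0 tent_le] := tent_le_lower_minkowski; exists K => // M S M0 mS.
have KM0 : 0 < K * M%:R `^ rho^-1 by rewrite mulr_gt0// powR_gt0// ltr0n.
rewrite leNgt; apply/negP; set y := tent _ _ / _ => Sy.
have low0 : (0 <= lower_minkowski nu S)%E by exact: lower_minkowski_ge0.
have y0 : 0 < y by rewrite -lte_fin; exact: le_lt_trans Sy.
have low_fin : lower_minkowski nu S \is a fin_num.
  by rewrite ge0_fin_numE// (lt_trans Sy)// ltry.
move: low0 Sy; rewrite -(fineK low_fin); set w := fine _; rewrite lee_fin lte_fin.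
(* The content [w] may be zero, whereas [tent_le] requires a positive [v]; the midpoint is positive
   and still less than [y]. *)
move=> w0 wy; pose v := (w + y) / 2.
have := tent_le M S v M0 mS ltac:(rewrite /v; lra).
rewrite -(fineK low_fin) lee_fin => /(_ ltac:(rewrite /v -/w; lra)).
rewrite mulrC -ler_pdivrMr// -/y /v; lra.
Qed.

End isoperimetry.

(** * Approximation by grid sets *)

Section approximable.
Context d (T : measurableType d) (R : realType) (P : probability T R).
Variable F : nat -> set (set T).
Hypothesis mF : forall m B, F m B -> measurable B.
Hypothesis F0 : F 0%N set0.
Hypothesis F_incr : forall m B, F m B -> F m.+1 B.
Hypothesis FC : forall m B, F m B -> F m (~` B).
Hypothesis FU : forall m B B', F m B -> F m B' -> F m (B `|` B').

Definition approximable (A : set T) := measurable A /\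
  forall e : R, 0 < e -> exists m B, F m B /\ (P (A `+` B) < e%:E)%E.

Let F_le m m' B : (m <= m')%N -> F m B -> F m' B.
Proof. by move=> /subnK <-; elim: (m' - m)%N => // k IH /IH; exact: F_incr. Qed.

Let mY (A B : set T) : measurable A -> measurable B -> measurable (A `+` B).
Proof. by move=> mA mB; apply: measurableU; exact: measurableD. Qed.

Let approx_le (A B C : set T) (e e' : R) : measurable A -> measurable B ->
  measurable C -> C `<=` A `|` B -> (P A < e%:E)%E -> (P B < e'%:E)%E ->
  (P C < (e + e')%:E)%E.
Proof.
move=> mA mB mC CAB Ae Be; rewrite EFinD; apply: le_lt_trans (lteD Ae Be).
apply: le_trans (measureU2 _ mA mB); apply: le_measure => //; rewrite inE//.
exact: measurableU.
Qed.

Lemma approximable0 : approximable set0.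
Proof.
split=> // e e0; exists 0%N, set0; split=> //.
by rewrite setY0 measure0 lte_fin.
Qed.

Lemma approximableC A : approximable A -> approximable (~` A).
Proof.
move=> [mA hA]; split=> [|e e0]; first exact: measurableC.
have [m [B [FB PB]]] := hA e e0; exists m, (~` B); split; first exact: FC.
by rewrite [X in P X](_ : _ = A `+` B)// /setY !setDE !setCK setUC ![_ `&` ~` _]setIC.
Qed.

Lemma approximableU A A' : approximable A -> approximable A' ->
  approximable (A `|` A').
Proof.
move=> [mA hA] [mA' hA']; split=> [|e e0]; first exact: measurableU.
have e20 : 0 < e / 2 by rewrite divr_gt0.
have [m [B [FB PB]]] := hA _ e20; have [m' [B' [FB' PB']]] := hA' _ e20.
exists (maxn m m'), (B `|` B'); split.
  by apply: FU; [apply: F_le FB; exact: leq_maxl|apply: F_le FB'; exact: leq_maxr].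
rewrite [e]splitr; apply: (approx_le _ _ _ _ PB PB').
- by apply: mY => //; exact: mF FB.
- by apply: mY => //; exact: mF FB'.
- by apply: mY; apply: measurableU => //; [exact: mF FB|exact: mF FB'].
by move=> x /=; have [Ax|Ax] := pselect (A x); have [Bx|Bx] := pselect (B x); tauto.
Qed.

Lemma approximable_bigcup (A : (set T)^nat) :
  (forall n, approximable (A n)) -> approximable (\bigcup_n A n).
Proof.
move=> hA; pose U n := \big[setU/set0]_(k < n) A k.
have hU n : approximable (U n).
  rewrite /U; elim: n => [|n IH]; first by rewrite big_ord0; exact: approximable0.
  by rewrite big_ord_recr/=; exact: approximableU.
have mA : measurable (\bigcup_n A n).
  by apply: bigcupT_measurable => n; have [] := hA n.
have UE : \bigcup_n U n = \bigcup_n A n.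
  apply/seteqP; split=> x [n _]; rewrite /U.
    by rewrite -bigcup_mkord => -[k _ Ax]; exists k.
  by move=> Ax; exists n.+1 => //; rewrite -bigcup_mkord; exists n => /=.
have cvgU : P \o U @ \oo --> P (\bigcup_n A n).
  rewrite -UE; apply: nondecreasing_cvg_mu => [n||].
  - by have [] := hU n.
  - by rewrite UE.
  by move=> n m nm; apply/subsetPset; exact: subset_bigsetU.
split=> // e e0; have e20 : 0 < e / 2 by rewrite divr_gt0.
have finA : P (\bigcup_n A n) \is a fin_num by exact: fin_num_measure.
have [n PUn] : exists n, fine (P (\bigcup_n A n)) - e / 2 < fine (P (U n)).
  move: cvgU; rewrite -{1}(fineK finA) => /fine_cvgP[_ cvgU].
  have [|n _ /(_ n (leqnn n))] := cvgr_gt _ cvgU (fine (P (\bigcup_n A n)) - e / 2).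
    by rewrite ltrBlDr ltrDl.
  by move=> h; exists n.
have [mU hUn] := hU n; have [m [B [FB PB]]] := hUn _ e20.
exists m, B; split=> //; have mB := mF FB.
rewrite [e]splitr; apply: (approx_le _ _ _ _ _ PB).
- exact: measurableD mA mU.
- exact: mY.
- exact: mY.
- move=> x /=; have [Ux|Ux] := pselect (U n x); have [Bx|Bx] := pselect (B x);
    have [Ax|Ax] := pselect ((\bigcup_n A n) x); try tauto.
  by exfalso; apply: Ax; rewrite -UE; exists n.
have -> : P (\bigcup_n A n `\` U n) = (P (\bigcup_n A n) - P (U n))%E.
  rewrite -[in X in _ = (_ - X)%E](_ : \bigcup_n A n `&` U n = U n).
    by apply: measureD => //; rewrite ltey_eq finA.
  by apply/setIidr; rewrite -UE; exact: bigcup_sup.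
have finU : P (U n) \is a fin_num by exact: fin_num_measure.
by rewrite -(fineK finA) -(fineK finU) -EFinB lte_fin ltrBlDr -ltrBlDl.
Qed.

(** The approximable sets form a sigma-algebra, countable unions being handled by continuity from
    below. *)
Lemma generated_approximable (G : set (set T)) : G `<=` approximable ->
  <<s G >> `<=` approximable.
Proof.
move=> GF; apply: smallest_sub => //; split.
- exact: approximable0.
- by move=> A hA; rewrite setTD; exact: approximableC.
- by move=> A hA; exact: approximable_bigcup.
Qed.

End approximable.

Section boxes.
Context d (T : measurableType d) (n : nat).

Definition box (B : 'I_n -> set T) : set (n.-tuple T) :=
  [set x | forall i, B i (tnth x i)].

Definition boxes : set (set (n.-tuple T)) :=
  [set box B | B in [set B | forall i, measurable (B i)]].

Lemma measurable_tnth_preimage (i : 'I_n) (Y : set T) : measurable Y ->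
  measurable [set x : n.-tuple T | Y (tnth x i)].
Proof.
move=> mY; rewrite -[X in measurable X]setTI.
exact: (@measurable_tnth _ T n i measurableT Y mY).
Qed.

Lemma measurable_box (B : 'I_n -> set T) : (forall i, measurable (B i)) ->
  measurable (box B).
Proof.
move=> mB; rewrite (_ : box B =
    \bigcap_(i in [set: 'I_n]) [set x | B i (tnth x i)]).
  by apply: fin_bigcap_measurable => // i _; exact: measurable_tnth_preimage.
by apply/seteqP; split=> x /= h i; [move=> _|]; exact: h.
Qed.

Lemma tuple_measurable_sub (C : set (set (n.-tuple T))) :
  sigma_algebra setT C ->
  (forall i (Y : set T), measurable Y -> C [set x | Y (tnth x i)]) ->
  measurable `<=` C.
Proof.
move=> sC CY; apply: smallest_sub => // A; rewrite -bigcup_seq => -[i _ [Y mY <-]].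
by rewrite setTI; exact: CY.
Qed.

Lemma box1E (i : 'I_n) (Y : set T) :
  [set x | Y (tnth x i)] = box (fun j => if j == i then Y else setT).
Proof.
apply/seteqP; split=> [x Yx j /=|x /(_ i)/=]; last by rewrite eqxx.
by case: eqP => // ->.
Qed.

Lemma measurable_boxesE : measurable = <<s boxes >> :> set (set (n.-tuple T)).
Proof.
apply/seteqP; split.
  apply: tuple_measurable_sub => [|i Y mY]; first exact: smallest_sigma_algebra.
  apply: sub_sigma_algebra; rewrite box1E; eexists; last reflexivity.
  by move=> j; case: ifP.
apply: smallest_sub; first exact: sigma_algebra_measurable.
by move=> _ [B mB <-]; exact: measurable_box.
Qed.

Lemma boxes_setI_closed : setI_closed boxes.
Proof.
move=> _ _ [B mB <-] [C mC <-]; exists (fun i => B i `&` C i).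
  by move=> i; exact: measurableI.
by apply/seteqP; split=> [x h|x [h h'] i]; [split=> i; have [] := h i|split].
Qed.

End boxes.

Section disintegration.
Context {R : realType} (nu : probability R R) (n : nat).
Implicit Types (i : 'I_n) (D : set (n.-tuple R)).
Local Notation nun := (power_prob nu n).

Definition replace i (z : n.-tuple R * R) : n.-tuple R :=
  [tuple (if j == i then z.2 else tnth z.1 j) | j < n].

Lemma measurable_replace i : measurable_fun [set: n.-tuple R * R] (replace i).
Proof.
apply/measurable_fun_tnthP => j.
rewrite (_ : _ \o _ = if j == i then snd else (fun x => tnth x j) \o fst).
  case: ifP => _; first exact: measurable_snd.
  by apply: measurableT_comp; [exact: measurable_tnth|exact: measurable_fst].
by apply/funext => z; rewrite /= tnth_mktuple; case: ifP.
Qed.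

HB.instance Definition _ i :=
  isMeasurableFun.Build _ _ _ _ (replace i) (@measurable_replace i).

Lemma xsection_replace i D x : xsection (replace i @^-1` D) x = axis_section D i x.
Proof. by apply/seteqP; split=> y; rewrite /xsection/= inE. Qed.

Lemma measurable_replace_preimage i D : measurable D ->
  measurable (replace i @^-1` D).
Proof.
by move=> mD; rewrite -[X in measurable X]setTI; exact: measurable_replace.
Qed.

Lemma measurable_axis_section i D x : measurable D -> measurable (axis_section D i x).
Proof.
move=> mD; rewrite -xsection_replace; apply: measurable_xsection.
exact: measurable_replace_preimage.
Qed.

Lemma measurable_fun_axis_section i D : measurable D ->
  measurable_fun [set: n.-tuple R] (fun x => nu (axis_section D i x)).
Proof.
move=> mD; under eq_fun do rewrite -xsection_replace.
exact: measurable_fun_xsection (measurable_replace_preimage i mD).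
Qed.

Lemma integral_axis_section i D : measurable D ->
  (\int[nun]_x nu (axis_section D i x) = nun D)%E.
Proof.
(* Resampling one coordinate preserves the product measure. *)
move=> mD; transitivity ((nun \x nu)%E (replace i @^-1` D)).
  by rewrite /product_measure1; apply: eq_integral => x _ /=; rewrite xsection_replace.
have boxE (B : 'I_n -> set R) : (forall i, measurable (B i)) ->
    nun (box B) = (\prod_(j < n) nu (B j))%E by exact: power_prob_box.
have resample_box (B : 'I_n -> set R) : (forall i, measurable (B i)) ->
    (nun \x nu)%E (replace i @^-1` box B) = nun (box B).
  move=> mB; rewrite boxE//; pose B' j := if j == i then setT else B j.
  have mB' j : measurable (B' j) by rewrite /B'; case: ifP.
  rewrite [X in (_ \x _)%E X](_ : _ = box B' `*` B i).
    rewrite product_measure1E//; last exact: measurable_box.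
    transitivity (\prod_(j < n) nu (B' j) * nu (B i))%E; first by rewrite -boxE.
    rewrite (bigD1 i)//= [in RHS](bigD1 i)//= /B' eqxx probability_setT mul1e.
    rewrite muleC; congr (_ * _)%E; apply: eq_bigr => j /negbTE ji.
    by rewrite ji.
  apply/seteqP; split=> -[x y] /=.
    move=> h; split=> [j|]; last by have := h i; rewrite tnth_mktuple eqxx.
    by have := h j; rewrite tnth_mktuple /B'; case: ifP.
  move=> [h Bi] j; rewrite tnth_mktuple; case: eqP => [->//|/eqP/negbTE ji].
  by have := h j; rewrite /B' ji.
have := @measure_unique _ R _ (@boxes _ R n) (fun=> setT) (measurable_boxesE _ _)
  (@boxes_setI_closed _ _ _) _ _ (pushforward (nun \x nu)%E (replace i)) nun.
apply => //.
- by move=> _; exists (fun=> setT) => //; apply/seteqP; split.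
- by rewrite bigcup_const//; exists 0%N.
- by move=> _ [B mB <-]; exact: resample_box.
- move=> _; change ((nun \x nu)%E (replace i @^-1` [set: n.-tuple R]) < +oo)%E.
  rewrite preimage_setT -setXTT product_measure1E//.
  rewrite [X in (_ * X)%E]probability_setT mule1.
  apply: le_lt_trans (probability_le1 nun measurableT) (ltry _).
Qed.

End disintegration.

Section finite_valued.
Context d (T : measurableType d) (R : realType) (P : probability T R).
Context (X : finType) (f : T -> X).
Hypothesis mf : forall b, measurable (f @^-1` [set b]).

Lemma integral_finite_valued (g : X -> R) : (forall b, 0 <= g b) ->
  (\int[P]_x (g (f x))%:E = \sum_b (g b)%:E * P (f @^-1` [set b]))%E.
Proof.
move=> g0; transitivity (\int[P]_x \sum_b ((g b)%:E * (\1_(f @^-1` [set b]) x)%:E))%E.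
  apply: eq_integral => x _; rewrite (bigD1 (f x))//= big1 => [|b bx].
    by rewrite adde0 indicE mem_set// mule1.
  by rewrite indicE memNset ?mule0//= => fb; rewrite fb eqxx in bx.
rewrite ge0_integral_sum//; last first.
- by move=> b x _; rewrite mule_ge0 ?lee_fin.
- by move=> b; apply/measurable_EFinP/measurable_funM => //; exact: measurable_indic.
apply: eq_bigr => b _; rewrite ge0_integralZl_EFin//; last first.
  by apply/measurable_EFinP; exact: measurable_indic.
by rewrite integral_indic// setIT.
Qed.

Lemma measurable_finite_valued (B : pred X) : measurable [set x | B (f x)].
Proof.
rewrite (_ : [set x | B (f x)] = \bigcup_(b in [set b | B b]) f @^-1` [set b]).
  by apply: fin_bigcup_measurable => [|b _]; [exact: finite_finset|exact: mf].
by apply/seteqP; split=> [x Bx|x [b Bb /= ->]//]; exists (f x).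
Qed.

Hypothesis unif : forall b, P (f @^-1` [set b]) = (#|X|%:R^-1)%:E.

Lemma integral_equidistributed (g : X -> R) : (forall b, 0 <= g b) ->
  (\int[P]_x (g (f x))%:E = (mean g)%:E)%E.
Proof.
move=> g0; rewrite integral_finite_valued// /mean mulr_suml -sumEFin.
by apply: eq_bigr => b _; rewrite unif EFinM.
Qed.

Lemma probability_equidistributed (B : pred X) :
  P [set x | B (f x)] = (mean (fun b => (B b)%:R))%:E.
Proof.
rewrite -integral_equidistributed//.
have mB := measurable_finite_valued B.
rewrite -[X in P X]setIT -integral_indic//.
apply: eq_integral => x _; rewrite indicE.
have [Bx|/negP Bx] := boolP (B (f x)); first by rewrite mem_set.
by rewrite memNset.
Qed.

End finite_valued.

Section finite_approximation.
Context d (T : measurableType d) (R : realType) (P : probability T R).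
Context (X : nat -> finType) (f : forall m, T -> X m).
Hypothesis mf : forall m b, measurable (f m @^-1` [set b]).
Hypothesis refine : forall m (Y : pred (X m)),
  exists Y' : pred (X m.+1), forall x, Y (f m x) = Y' (f m.+1 x).

Definition finite_approximable (A : set T) :=
  measurable A /\ forall e : R, 0 < e ->
    exists m (Y : pred (X m)), (P (A `+` [set x | Y (f m x)]) < e%:E)%E.

Lemma generated_finite_approximable (C : set (set T)) :
  C `<=` finite_approximable -> <<s C >> `<=` finite_approximable.
Proof.
pose F m : set (set T) := [set B | exists Y : pred (X m), B = [set x | Y (f m x)]].
have FE A : finite_approximable A <-> approximable P F A.
  split=> -[mA hA]; split=> // e e0.
    by have [m [Y PY]] := hA e e0; exists m, [set x | Y (f m x)]; split=> //; exists Y.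
  by have [m [_ [[Y ->] PY]]] := hA e e0; exists m, Y.
move=> hC A /(@generated_approximable _ _ _ P F) hA; apply/FE; apply: hA.
- by move=> m _ [Y ->]; exact: (measurable_finite_valued (@mf m)).
- by exists pred0; apply/seteqP; split.
- move=> m _ [Y ->]; have [Y' YY'] := refine Y; exists Y'.
  by apply/seteqP; split=> x /=; rewrite YY'.
- move=> m _ [Y ->]; exists (fun k => ~~ Y k).
  by apply/seteqP; split=> x /= /negP.
- move=> m _ _ [Y ->] [Y' ->]; exists (fun k => Y k || Y' k).
  by apply/seteqP; split=> x /= /orP.
by move=> B /hC /FE.
Qed.

End finite_approximation.

(** * Quantile cells of the Boltzmann measure and of its powers *)

Section quantile_grid.
Context {R : realType} (rho : R) (rho_gt1 : 1 < rho).
Local Notation phi := (boltzmann_pdf rho).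
Local Notation nu := (boltzmann_prob (ltW rho_gt1)).
Local Notation mu := (@lebesgue_measure R).

Definition boltzmann_cdf (x : R) : R := fine (nu `]-oo, x]).
Local Notation G := boltzmann_cdf.

Lemma boltzmann_cdfE x : (G x)%:E = nu `]-oo, x].
Proof. by rewrite fineK// fin_num_measure. Qed.

Lemma boltzmann_cdfB (x y : R) : x <= y -> (G y - G x)%:E = nu `]x, y].
Proof.
move=> xy; rewrite EFinB !boltzmann_cdfE.
have <- : `]-oo, y] `\` `]-oo, x] = `]x, y]%classic.
  apply/seteqP; split=> z /=; rewrite !in_itv/=.
    by move=> [zy /negP]; rewrite -ltNge => ->.
  by move=> /andP[xz zy]; split=> //; apply/negP; rewrite -ltNge.
have IE : `]-oo, y] `&` `]-oo, x] = `]-oo, x]%classic.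
  by apply/setIidr => z /=; rewrite !in_itv/= => /le_trans; exact.
rewrite -[in LHS]IE; apply/esym/measureD => //.
by rewrite (le_lt_trans (probability_le1 nu _)) ?ltry.
Qed.

Lemma boltzmann_cdf_lt (x y : R) : x < y -> G x < G y.
Proof.
move=> xy; rewrite -subr_gt0 -lte_fin boltzmann_cdfB ?(ltW xy)//.
pose c := Num.max `|x| `|y|.
apply: (@lt_le_trans _ _ (phi c * (y - x))%:E).
  by rewrite lte_fin mulr_gt0 ?boltzmann_pdf_gt0 ?subr_gt0.
apply: (@le_trans _ _ (nu `]x, y[)).
  apply: boltzmann_itv_ge; first exact: ltW.
    by rewrite lerNl (le_trans (ler_norm _))// normrN le_max lexx.
  by rewrite (le_trans (ler_norm _))// le_max lexx orbT.
by apply: le_boltzmann => z /=; rewrite !in_itv/= => /andP[-> /ltW].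
Qed.

Lemma boltzmann_cdf_lipschitz (x y : R) : x <= y -> G y - G x <= phi 0 * (y - x).
Proof.
move=> xy; rewrite -lee_fin boltzmann_cdfB//.
apply: (@le_trans _ _ (\int[mu]_(z in `]x, y]) cst (phi 0)%:E z)%E).
  apply: le_lower_integral => z _; rewrite lee_fin ?(ltW (boltzmann_pdf_gt0 rho_gt1 _))//.
  by rewrite boltzmann_pdf_le// normr0.
rewrite integral_cst//= lebesgue_measure_itv/= lte_fin.
move: xy; rewrite le_eqVlt => /predU1P[->|->]; last by [].
by rewrite ltxx subrr mule0 mulr0.
Qed.

Lemma continuous_boltzmann_cdf : continuous G.
Proof.
have lip x y : `|G y - G x| <= phi 0 * `|y - x|.
  have [xy|/ltW yx] := leP x y; last rewrite distrC [X in _ * X]distrC.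
    rewrite !ger0_norm ?subr_ge0//; first exact: boltzmann_cdf_lipschitz.
    by move: xy; rewrite le_eqVlt => /predU1P[->//|/boltzmann_cdf_lt/ltW].
  rewrite !ger0_norm ?subr_ge0//; first exact: boltzmann_cdf_lipschitz.
  by move: yx; rewrite le_eqVlt => /predU1P[->//|/boltzmann_cdf_lt/ltW].
move=> x; apply/cvgrPdist_lt => e e0; have phi0 := boltzmann_pdf_gt0 rho_gt1 0.
near=> y; rewrite distrC; apply: le_lt_trans (lip _ _) _.
rewrite mulrC -ltr_pdivlMr//; near: y.
have d0 : 0 < e / phi 0 by rewrite divr_gt0.
exists (e / phi 0) => //= y; by rewrite /ball_/= distrC.
Unshelve. all: end_near.
Qed.

Lemma boltzmann_cdf_ge0 x : 0 <= G x.
Proof. by rewrite fine_ge0. Qed.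

Lemma boltzmann_cdf_le1 x : G x <= 1.
Proof. by rewrite -lee_fin boltzmann_cdfE probability_le1. Qed.

Lemma boltzmann_cdf_lt1 x : G x < 1.
Proof.
by rewrite (lt_le_trans (@boltzmann_cdf_lt x (x + 1) _)) ?boltzmann_cdf_le1// ltrDl.
Qed.

Lemma boltzmann_small_tail (e : R) : 0 < e ->
  exists b, (nu [set x | (b <= `|x|)%R] < e%:E)%E.
Proof.
move=> e0; have [z z0 phiE] := boltzmann_pdfE rho_gt1.
have z20 : 0 < 2 * z by rewrite pmulr_rgt0.
(* For b >= 1 the tail is at most 2 z e^-b, which is less than 2 z / b. *)
pose b := 1 + 2 * z / e; exists b.
have b1 : 1 <= b by rewrite lerDl ltW// divr_gt0.
have be : 2 * z < e * b.
  by rewrite /b mulrDr mulr1 mulrCA mulfV ?gt_eqF// mulr1 ltrDr.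
clearbody b; have b0 : 0 < b by exact: lt_le_trans b1.
apply: le_lt_trans (boltzmann_tail_le rho_gt1 b0) _; rewrite lte_fin phiE ger0_norm ?ltW//.
rewrite mulrA; set E := expR _; have E0 : 0 < E by exact: expR_gt0.
apply: (@le_lt_trans _ _ (2 * z * E)).
  rewrite ler_pdivrMr ?powR_gt0// ler_peMr//; first by rewrite ltW// mulr_gt0.
  by rewrite -[leLHS](powRr0 b) ler_powR// subr_ge0 ltW.
apply: (@le_lt_trans _ _ (2 * z / b)); last by rewrite ltr_pdivrMr.
rewrite ler_pM2l// /E expRN lef_pV2 ?posrE ?expR_gt0//.
apply: le_trans (le_trans (expR_ge1Dx b) _); first by rewrite lerDr.
by rewrite ler_expR le1r_powR// ltW.
Qed.

Lemma boltzmann_cdf_surj u : 0 < u < 1 -> exists x, G x = u.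
Proof.
move=> /andP[u0 u1].
have [b bu] : exists b, u < G b.
  have [|b hb] := @boltzmann_small_tail (1 - u); first by rewrite subr_gt0.
  exists b; rewrite -lte_fin boltzmann_cdfE.
  have : (nu (~` `]-oo, b]) < (1 - u)%:E)%E.
    apply: le_lt_trans hb; apply: le_boltzmann => x /=; rewrite in_itv/= => /negP.
    by rewrite -ltNge => /ltW /le_trans; apply; exact: ler_norm.
  have -> : nu (~` `]-oo, b]) = (1 - nu `]-oo, b])%E by exact: probability_setC.
  by rewrite -boltzmann_cdfE -EFinB !lte_fin; lra.
have [a au] : exists a, G a < u.
  have [a ha] := boltzmann_small_tail u0.
  exists (- a); rewrite -lte_fin boltzmann_cdfE; apply: le_lt_trans ha.
  apply: le_boltzmann => x /=; rewrite in_itv/= lerNr => /le_trans; apply.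
  by rewrite -normrN ler_norm.
have ab : a <= b.
  rewrite leNgt; apply/negP => /boltzmann_cdf_lt; lra.
have [|c _ cu] := @IVT R G a b u ab (continuous_subspaceT continuous_boltzmann_cdf).
  by rewrite ge_min le_max (ltW au) (ltW bu) orbT.
by exists c.
Qed.

Lemma boltzmann_cdf_uniform u : 0 <= u <= 1 -> nu [set x | G x < u] = u%:E.
Proof.
(* The values 0 and 1 are not attained by [G], so they are treated apart from the quantile
   argument. *)
move=> /andP[]; rewrite le_eqVlt => /predU1P[<- _|u0].
  rewrite (_ : [set x | _] = set0) ?measure0//.
  by apply/seteqP; split=> x //=; rewrite ltNge boltzmann_cdf_ge0.
rewrite le_eqVlt => /predU1P[->|u1].
  rewrite (_ : [set x | _] = setT) ?probability_setT//.
  by apply/seteqP; split=> x //= _; exact: boltzmann_cdf_lt1.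
have [q qu] : exists q, G q = u by apply: boltzmann_cdf_surj; rewrite u0.
have -> : [set x | G x < u] = `]-oo, q[%classic.
  apply/seteqP; split=> x /=; rewrite in_itv/= -qu; last exact: boltzmann_cdf_lt.
  apply: contraTT; rewrite -!leNgt le_eqVlt => /predU1P[->//|/boltzmann_cdf_lt/ltW//].
rewrite -qu boltzmann_cdfE /boltzmann_prob.
apply: integral_itv_bndo_bndc; apply/measurable_EFinP/measurable_funTS.
exact: measurable_boltzmann_pdf.
Qed.

Lemma measurable_boltzmann_cdf_lt u : measurable [set x | G x < u].
Proof.
rewrite -[X in measurable X]setTI.
have mG : measurable_fun [set: R] G.
  by apply: continuous_measurable_fun; exact: continuous_boltzmann_cdf.
have := @measurable_fun_ltr _ _ _ setT G (cst u) mG (measurable_cst _).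
move=> /(_ measurableT [set true]); exact.
Qed.

Lemma ltn_quantile m x : (Num.trunc ((2 ^ m)%:R * G x) < 2 ^ m)%N.
Proof.
rewrite truncn_lt_nat ?mulr_ge0 ?boltzmann_cdf_ge0//.
by rewrite -[ltRHS]mulr1 ltr_pM2l ?boltzmann_cdf_lt1// ltr0n expn_gt0.
Qed.

Definition quantile m x : 'I_(2 ^ m) := Ordinal (ltn_quantile m x).

Lemma quantile_ltE m x k : (quantile m x < k)%N = (G x < k%:R / (2 ^ m)%:R).
Proof.
rewrite /= truncn_lt_nat ?mulr_ge0 ?boltzmann_cdf_ge0//.
by rewrite ltr_pdivlMr ?ltr0n ?expn_gt0// mulrC.
Qed.

Lemma quantile_div2 m x : (quantile m.+1 x)./2 = quantile m x.
Proof.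
rewrite /=; set g := G x; apply/esym/truncn_def.
have g0 : 0 <= (2 ^ m.+1)%:R * g by rewrite mulr_ge0 ?boltzmann_cdf_ge0.
have /andP[kg gk] := truncn_itv g0; set k := Num.trunc _ in kg gk *.
rewrite expnS natrM -mulrA in kg gk.
have h1 : (k./2)%:R * 2 <= k%:R :> R.
  by rewrite -natrM ler_nat -[leqRHS]odd_double_half muln2 leq_addl.
have h2 : k.+1%:R <= (k./2).+1%:R * 2 :> R.
  rewrite -natrM ler_nat muln2 doubleS -{1}(odd_double_half k).
  by case: (odd k).
set w := (2 ^ m)%:R * g in kg gk *.
by apply/andP; split; lra.
Qed.

Lemma measurable_quantile m k : measurable (quantile m @^-1` [set k]).
Proof.
rewrite (_ : _ @^-1` _ = [set x | G x < k.+1%:R / (2 ^ m)%:R] `\`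
    [set x | G x < k%:R / (2 ^ m)%:R]).
  by apply: measurableD; exact: measurable_boltzmann_cdf_lt.
apply/seteqP; split=> x /=.
  by move=> <-; rewrite -!quantile_ltE ltnn ltnS leqnn.
rewrite -!quantile_ltE => -[xk /negP]; rewrite -leqNgt => kx.
by apply/val_inj/eqP; rewrite eqn_leq -ltnS xk kx.
Qed.

Lemma probability_quantile m k :
  nu (quantile m @^-1` [set k]) = (#|'I_(2 ^ m)|%:R^-1)%:E.
Proof.
have N0 : 0 < (2 ^ m)%:R :> R by rewrite ltr0n expn_gt0.
rewrite (_ : _ @^-1` _ = [set x | G x < k.+1%:R / (2 ^ m)%:R] `\`
    [set x | G x < k%:R / (2 ^ m)%:R]); last first.
  apply/seteqP; split=> x /=.
    by move=> <-; rewrite -!quantile_ltE ltnn ltnS leqnn.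
  rewrite -!quantile_ltE => -[xk /negP]; rewrite -leqNgt => kx.
  by apply/val_inj/eqP; rewrite eqn_leq -ltnS xk kx.
set U := [set x | G x < _]; set V := [set x | G x < _].
have VU : U `&` V = V.
  apply/setIidr => x /= /lt_le_trans; apply.
  by rewrite ler_pM2r ?invr_gt0// ler_nat.
transitivity (nu U - nu V)%E.
  rewrite -[in RHS]VU; apply: measureD; try exact: measurable_boltzmann_cdf_lt.
  rewrite (le_lt_trans (probability_le1 nu _)) ?ltry//.
  exact: measurable_boltzmann_cdf_lt.
have kN := ltn_ord k.
have frac01 (j : nat) : (j <= 2 ^ m)%N -> 0 <= (j%:R / (2 ^ m)%:R : R) <= 1.
  move=> jN; rewrite divr_ge0//= ?(ltW N0)// ler_pdivrMr// mul1r ler_nat//.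
rewrite !boltzmann_cdf_uniform ?frac01//; last exact: ltnW.
by rewrite -EFinB -mulrBl -natrB// subSnn mul1r card_ord.
Qed.

(** The shift by [M] makes every approximating grid have at least [M] digits, as
    [discrete_influence_bound] demands. *)
Lemma boltzmann_finite_approximable M (A : set R) : measurable A ->
  finite_approximable nu (fun m => quantile (m + M)) A.
Proof.
move=> mA; have : <<s @RGenInftyO.G R >> A.
  suff : (@RGenInftyO.G R).-sigma.-measurable A by [].
  by rewrite -RGenInftyO.measurableE.
apply: generated_finite_approximable => [m b|m Y|].
- exact: measurable_quantile.
- exists (fun k : 'I_(2 ^ (m.+1 + M)) => [exists j, Y j && (j == k./2 :> nat)]) => x.
  apply/idP/existsP => [Yx|[j /andP[Yj /eqP jx]]].
    by exists (quantile (m + M) x); rewrite Yx -quantile_div2/=.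
  suff -> : quantile (m + M) x = j by [].
  by apply: ord_inj; rewrite -quantile_div2; exact: esym jx.
move=> _ [q ->]; split=> // e e0.
(* On a generating half-line, keeping the cells below the integer part of N G(q) leaves an error
   less than 1 / N. *)
have [m me] : exists m, ((2 ^ (m + M))%:R)^-1 < e.
  exists (Num.trunc e^-1).+1; rewrite invf_plt ?posrE ?ltr0n ?expn_gt0//.
  have /truncn_itv/andP[_] : 0 <= e^-1 by rewrite invr_ge0 ltW.
  move=> /lt_le_trans; apply; rewrite ler_nat.
  by rewrite (leq_trans (ltnW (ltn_expl _ (ltnSn 1))))// leq_exp2l// leq_addr.
set N := (2 ^ (m + M))%N in me.
have N0 : 0 < N%:R :> R by rewrite ltr0n expn_gt0.
have g0 : 0 <= N%:R * G q by rewrite mulr_ge0 ?boltzmann_cdf_ge0.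
have /andP[kq qk] := truncn_itv g0; set k := Num.trunc _ in kq qk.
exists m, (fun j : 'I_(2 ^ (m + M)) => (j < k)%N).
pose U := [set x | G x < G q]; pose V := [set x | G x < k%:R / N%:R].
have UE : `]-oo, q[%classic = U.
  apply/seteqP; split=> x /=; rewrite in_itv/=; first exact: boltzmann_cdf_lt.
  by apply: contraTT; rewrite -!leNgt le_eqVlt => /predU1P[->//|/boltzmann_cdf_lt/ltW].
have VE : [set x | (quantile (m + M) x < k)%N] = V.
  by apply: eq_set => x; rewrite quantile_ltE.
have kq' : k%:R / N%:R <= G q by rewrite ler_pdivrMr// mulrC.
have VU : V `<=` U by move=> x /= /lt_le_trans; apply.
have mU : measurable U by exact: measurable_boltzmann_cdf_lt.
have mV : measurable V by exact: measurable_boltzmann_cdf_lt.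
rewrite UE VE /setY (_ : V `\` U = set0) ?setU0; last first.
  by apply/seteqP; split=> x //= [/VU].
suff : (nu (U `\` V) < e%:E)%E by [].
have -> : nu (U `\` V) = (nu U - nu V)%E.
  rewrite -[in RHS](setIidr VU); apply: measureD => //.
  by rewrite (le_lt_trans (probability_le1 nu _)) ?ltry.
have G01 : 0 <= G q <= 1 by rewrite boltzmann_cdf_ge0 boltzmann_cdf_le1.
rewrite !boltzmann_cdf_uniform//; last first.
  by rewrite divr_ge0//= (le_trans kq')//; case/andP: G01.
rewrite -EFinB lte_fin; apply: lt_trans me.
rewrite ltrBlDr -[X in X + _]mul1r -mulrDl ltr_pdivlMr// mulrC.
by rewrite addrC natr1.
Qed.

Section power.
Context (n : nat).
Local Notation nun := (power_prob nu n).
Local Notation grid m := {ffun 'I_n -> 'I_(2 ^ m)}.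

Definition grid_cell m (x : n.-tuple R) : grid m := [ffun i => quantile m (tnth x i)].

Lemma grid_cell_box m (z : grid m) :
  grid_cell m @^-1` [set z] = box (fun i => quantile m @^-1` [set z i]).
Proof.
apply/seteqP; split=> x /=; first by move=> <- i /=; rewrite ffunE.
by move=> h; apply/ffunP => i; rewrite ffunE; exact: h.
Qed.

Lemma measurable_grid_cell m (z : grid m) : measurable (grid_cell m @^-1` [set z]).
Proof.
by rewrite grid_cell_box; apply: measurable_box => i; exact: measurable_quantile.
Qed.

Lemma probability_grid_cell m (z : grid m) :
  nun (grid_cell m @^-1` [set z]) = (#|{: grid m}|%:R^-1)%:E.
Proof.
rewrite grid_cell_box; transitivity (\prod_(i < n) nu (quantile m @^-1` [set z i]))%E.
  by apply: power_prob_box => i; exact: measurable_quantile.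
under eq_bigr do rewrite probability_quantile.
by rewrite prodEFin prodr_const card_ffun !card_ord exprVn -natrX.
Qed.

Lemma power_prob_marginal i (Y : set R) : measurable Y ->
  nun [set x | Y (tnth x i)] = nu Y.
Proof.
move=> mY; rewrite box1E.
transitivity (\prod_(j < n) nu (if j == i then Y else setT))%E.
  by apply: power_prob_box => j; case: ifP.
rewrite (bigD1 i)//= eqxx big1 ?mule1// => j /negbTE ->.
exact: probability_setT.
Qed.

Lemma power_finite_approximable M (A : set (n.-tuple R)) : measurable A ->
  finite_approximable nun (fun m => grid_cell (m + M)) A.
Proof.
pose C : set (set (n.-tuple R)) :=
  [set D | exists i Y, measurable Y /\ D = [set x | Y (tnth x i)]].
have mC : measurable `<=` <<s C >>.
  apply: tuple_measurable_sub => [|i Y mY]; first exact: smallest_sigma_algebra.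
  by apply: sub_sigma_algebra; exists i, Y.
move=> /mC; apply: generated_finite_approximable => [m z|m Y|].
- exact: measurable_grid_cell.
- exists (fun z : grid (m.+1 + M) =>
    [exists w, Y w && [forall i, w i == (z i)./2 :> nat]]) => x.
  apply/idP/existsP => [Yx|[w /andP[Yw /forallP wx]]].
    exists (grid_cell (m + M) x); rewrite Yx; apply/forallP => i.
    by rewrite !ffunE -quantile_div2.
  suff -> : grid_cell (m + M) x = w by [].
  apply/ffunP => i; apply: ord_inj; have /eqP := wx i.
  by rewrite !ffunE => ->; exact: esym (quantile_div2 _ _).
move=> _ [i [Y [mY ->]]]; split=> [|e e0]; first exact: measurable_tnth_preimage.
have [_ hY] := boltzmann_finite_approximable M mY.
have [m [Y' PY']] := hY e e0.
exists m, (fun z : grid (m + M) => Y' (z i)).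
pose D := Y `+` [set y | Y' (quantile (m + M) y)].
rewrite (_ : _ `+` _ = [set x | D (tnth x i)]).
  suff : (nun [set x | D (tnth x i)] < e%:E)%E by [].
  rewrite power_prob_marginal//; apply: measurableU; apply: measurableD => //.
    exact: (measurable_finite_valued (@measurable_quantile (m + M))).
  exact: (measurable_finite_valued (@measurable_quantile (m + M))).
by apply/seteqP; split=> x; rewrite /D /setY /= ffunE.
Qed.

Lemma axis_section_grid_cell m (B : {set grid m}) i x :
  nu (axis_section [set x | grid_cell m x \in B] i x) =
  ((fiber_card B i (grid_cell m x))%:R / (2 ^ m)%:R)%:E.
Proof.
rewrite (_ : axis_section _ _ _ =
    [set y | upd (grid_cell m x) i (quantile m y) \in B]).
  rewrite (probability_equidistributed (@measurable_quantile m) (@probability_quantile m)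
    (fun k => upd (grid_cell m x) i k \in B)).
  by rewrite /mean card_ord /fiber_card card_set_lt natr_sum.
rewrite /axis_section; apply: eq_set => y /=.
set z := grid_cell m [tuple _ | j < n].
suff -> : z = upd (grid_cell m x) i (quantile m y) by [].
apply/ffunP => j; rewrite /z.
by rewrite !ffunE tnth_mktuple; case: eqP.
Qed.

(** Each of the [M] summands is 1-Lipschitz. *)
Lemma tent_lipschitz M (s s' : R) : tent M s' <= tent M s + M%:R * `|s' - s|.
Proof.
rewrite mulr_natl -[X in _ *+ X](card_ord M) -sumr_const -big_split/=.
apply: ler_sum => b _; have := ler_norm (s' - s); have := lerNnormlW (lexx `|s' - s|).
rewrite /Num.min; do ?case: ifP => //; lra.
Qed.

End power.

End quantile_grid.

(** * Transfer to the product measure *)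

Lemma probability_dist_le d (T : measurableType d) (R : realType)
    (P : probability T R) (A B : set T) : measurable A -> measurable B ->
  `|fine (P A) - fine (P B)| <= fine (P (A `+` B)).
Proof.
move=> mA mB.
have mAB : measurable (A `+` B) by apply: measurableU; exact: measurableD.
have half (C D : set T) : measurable C -> measurable D -> measurable (C `+` D) ->
    fine (P C) - fine (P D) <= fine (P (C `+` D)).
  move=> mC mD mCD; rewrite lerBlDl -lee_fin EFinD !fineK ?fin_num_measure//.
  have UE : (P (D `|` (C `+` D)) <= P D + P (C `+` D))%E by exact: measureU2.
  apply: le_trans UE; apply: le_measure; rewrite ?inE//; first exact: measurableU.
  by move=> x Cx /=; have [Dx|Dx] := pselect (D x); [left|right; left].
by rewrite ler_norml half//= lerNl opprB setYC half// setYC.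
Qed.

Lemma measurable_tent (R : realType) M : measurable_fun [set: R] (@tent R M).
Proof.
apply: measurable_sum => b; apply: measurable_minr => //.
by apply: measurable_minr => //; exact: measurable_funB.
Qed.

Section transfer.
Context {R : realType} (rho : R) (rho_gt1 : 1 < rho) (n : nat).
Local Notation nu := (boltzmann_prob (ltW rho_gt1)).
Local Notation nun := (power_prob nu n).

Definition tent_influence M (A : set (n.-tuple R)) (i : 'I_n) : \bar R :=
  (\int[nun]_x (tent M (fine (nu (axis_section A i x))))%:E)%E.

Lemma tent_section_ge0 M (A : set (n.-tuple R)) i x : measurable A ->
  0 <= tent M (fine (nu (axis_section A i x))).
Proof.
by move=> mA; apply/tent_ge0/fine_boltzmann01; exact: measurable_axis_section.
Qed.

Lemma measurable_tent_section M (A : set (n.-tuple R)) i : measurable A ->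
  measurable_fun [set: n.-tuple R]
    (fun x => (tent M (fine (nu (axis_section A i x))))%:E).
Proof.
move=> mA; apply/measurable_EFinP; apply: (measurableT_comp (@measurable_tent R M)).
by apply: measurableT_comp => //; exact: measurable_fun_axis_section.
Qed.

(** Sections commute with symmetric differences, so the Lipschitz bound of [tent] holds section by
    section and [integral_axis_section] integrates it. *)
Lemma tent_influence_dist M (A A' : set (n.-tuple R)) i :
  measurable A -> measurable A' ->
  (tent_influence M A' i <= tent_influence M A i + M%:R%:E * nun (A `+` A'))%E.
Proof.
move=> mA mA'.
have mD : measurable (A `+` A') by apply: measurableU; exact: measurableD.
rewrite -(integral_axis_section nu i mD) -ge0_integralZl_EFin//; last first.
  exact: measurable_fun_axis_section.
rewrite /tent_influence -ge0_integralD//; first last.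
- by apply: emeasurable_funM => //; exact: measurable_fun_axis_section.
- by move=> x _; rewrite mule_ge0// lee_fin.
- exact: measurable_tent_section.
- by move=> x _; rewrite lee_fin tent_section_ge0.
apply: le_lower_integral => x _; first by rewrite lee_fin tent_section_ge0.
have mS := measurable_axis_section i x mA; have mS' := measurable_axis_section i x mA'.
have DE : axis_section (A `+` A') i x = axis_section A i x `+` axis_section A' i x.
  by [].
have finD : nu (axis_section (A `+` A') i x) \is a fin_num.
  by apply: fin_num_measure; exact: measurable_axis_section.
suff : ((tent M (fine (nu (axis_section A' i x))))%:E <=
    (tent M (fine (nu (axis_section A i x))))%:E +
    M%:R%:E * nu (axis_section (A `+` A') i x))%E by [].
rewrite -(fineK finD) -EFinM -EFinD lee_fin.
apply: le_trans (tent_lipschitz M (fine (nu (axis_section A i x))) _) _.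
rewrite lerD2l ler_wpM2l// distrC DE.
exact: probability_dist_le.
Qed.

Lemma power_influence_bound M k (A : set (n.-tuple R)) (a a' s t : R) :
  (0 < M)%N -> measurable A -> nun A = t%:E ->
  (forall i, (tent_influence M A i <= a%:E)%E) -> a < a' -> 0 <= s -> 2 * a' <= s ^+ 2 ->
  t * (1 - t) <= n%:R * a' / M%:R + (3 ^+ k * s + k.+1%:R^-1) * (n%:R * a' / 2).
Proof.
move=> M0 mA At Aa aa' s0 as2; apply/ler_addgt0Pr => e e0.
have M0' : 0 < M%:R :> R by rewrite ltr0n.
(* The first bound controls the change of [t], the second keeps the tent influences below [a']. *)
pose e' := Num.min e ((a' - a) / M%:R).
have e'0 : 0 < e' by rewrite lt_min e0 divr_gt0// subr_gt0.
have [_ hA] := power_finite_approximable rho_gt1 M mA.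
have [m [Y PY]] := hA e' e'0.
pose B := [set z : {ffun 'I_n -> 'I_(2 ^ (m + M))} | Y z]%SET.
pose A' := [set x : n.-tuple R | grid_cell rho_gt1 (m + M) x \in B].
have A'E : A' = [set x | Y (grid_cell rho_gt1 (m + M) x)].
  by apply: eq_set => x; rewrite inE.
have mA' : measurable A'.
  exact: (measurable_finite_valued (@measurable_grid_cell _ _ rho_gt1 n (m + M))).
have De' : (nun (A `+` A') < e'%:E)%E by rewrite A'E.
have unif := @probability_grid_cell _ _ rho_gt1 n (m + M).
have mcell := @measurable_grid_cell _ _ rho_gt1 n (m + M).
have cell_le1 z i : 0 <= ((fiber_card B i z)%:R / (2 ^ (m + M))%:R : R) <= 1.
  have N0 : 0 < (2 ^ (m + M))%:R :> R by rewrite ltr0n expn_gt0.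
  by rewrite divr_ge0//= ler_pdivrMr// mul1r ler_nat fiber_card_le.
have infl i : mean (fun z => tent M ((fiber_card B i z)%:R / (2 ^ (m + M))%:R)) <= a'.
  rewrite -lee_fin -(integral_equidistributed mcell unif) => [|z]; last exact: tent_ge0.
  have -> : (\int[nun]_x (tent M ((fiber_card B i (grid_cell rho_gt1 (m + M) x))%:R /
      (2 ^ (m + M))%:R))%:E)%E = tent_influence M A' i.
    by apply: eq_integral => x _; rewrite axis_section_grid_cell.
  apply: le_trans (tent_influence_dist M i mA mA') _.
  have -> : a' = a + M%:R * ((a' - a) / M%:R).
    by rewrite mulrC divfK ?gt_eqF// addrC subrK.
  rewrite EFinD leeD// EFinM lee_pmul2l//.
  by rewrite (le_trans (ltW De'))// lee_fin ge_min lexx orbT.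
pose t' := mean (fun z => (z \in B)%:R : R).
have A't' : nun A' = t'%:E.
  exact: (probability_equidistributed mcell unif).
have tt' : `|t - t'| <= e.
  have := probability_dist_le nun mA mA'; rewrite At A't'/= => /le_trans; apply.
  rewrite -lee_fin fineK; last first.
    by apply: fin_num_measure; apply: measurableU; exact: measurableD.
  by rewrite (le_trans (ltW De'))// lee_fin ge_min lexx.
have t01 : 0 <= t <= 1.
  by rewrite -!lee_fin -At measure_ge0 probability_le1.
have t'01 : 0 <= t' <= 1.
  by rewrite -!lee_fin -A't' measure_ge0 probability_le1.
have M0m : (0 < M <= m + M)%N by rewrite M0 leq_addl.
have := discrete_influence_bound k M0m infl s0 as2.
rewrite /= -/t' => main.
(* The map t (1 - t) is 1-Lipschitz on [0, 1]. *)
apply: (@le_trans _ _ (t' * (1 - t') + e)); last by rewrite lerD2r.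
move: tt'; rewrite ler_norml => /andP[h1 h2].
nra.
Qed.

End transfer.

(** * Choice of the parameters and conclusion *)

(** The left side is at most (8 * 9)^k = 72^k. The base 256 = 2^8 matches k = M / 8, so that 256^k
    <= 2^M <= n. *)
Lemma cube72_le k : (k.+1 ^ 3 * 9 ^ k <= 256 ^ k)%N.
Proof.
have k2 : (k.+1 <= 2 ^ k)%N by rewrite ltn_expl.
apply: (@leq_trans ((2 ^ k) ^ 3 * 9 ^ k)); first by rewrite leq_mul2r leq_exp2r// k2 orbT.
rewrite -expnM (mulnC k) expnM -expnMn.
by case: k {k2} => // k; rewrite leq_exp2r.
Qed.

Section numeric.
Context {R : realType}.

(* The choice of the threshold level: with k about M/8, the low-level term
   3^k s is of the order of the high-level term 1/k, although 2 a <= s^2. *)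
Lemma bound_lt (n M k : nat) (tau : R) : 0 < tau <= 4^-1 -> (2 ^ M <= n)%N ->
  k = (M %/ 8)%N -> (0 < M)%N ->
  let a := tau * M%:R / (100 * n%:R) in
  let s := (3 ^+ k * k.+1%:R)^-1 in
  2 * a <= s ^+ 2 /\
  n%:R * a / M%:R + (3 ^+ k * s + k.+1%:R^-1) * (n%:R * a / 2) < tau.
Proof.
move=> /andP[tau0 tau1] Mn kE M0 a s.
have n0 : 0 < n%:R :> R by rewrite ltr0n (leq_trans _ Mn)// expn_gt0.
have M0' : 0 < M%:R :> R by rewrite ltr0n.
have k0 : 0 < k.+1%:R :> R by rewrite ltr0n.
have p0 : 0 < 3 ^+ k :> R by rewrite exprn_gt0.
have Mk : M%:R <= 8 * k.+1%:R :> R by rewrite -natrM ler_nat kE; lia.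
(* 9^k and two factors k + 1 make up s^-2; the third one absorbs M <= 8 (k + 1). *)
have kn : k.+1%:R ^+ 3 * 9 ^+ k <= n%:R :> R.
  rewrite -!natrX -natrM ler_nat (leq_trans (cube72_le k))// (leq_trans _ Mn)//.
  by rewrite -[256%N]/(2 ^ 8)%N -expnM leq_exp2l// kE; lia.
split.
  pose P : R := 9 ^+ k * k.+1%:R ^+ 2.
  have P0 : 0 < P by rewrite mulr_gt0 ?exprn_gt0.
  have -> : s ^+ 2 = P^-1.
    by rewrite /s exprVn exprMn -exprM mulnC exprM /P; congr ((_ ^+ k * _)^-1); ring.
  have MP : M%:R * P <= 8 * n%:R.
    apply: (@le_trans _ _ (8 * k.+1%:R * P)); first by rewrite ler_pM2r.
    rewrite -mulrA ler_pM2l//; apply: le_trans kn.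
    by rewrite le_eqVlt; apply/orP; left; apply/eqP; rewrite /P; ring.
  have MP0 : 0 <= M%:R * P by rewrite mulr_ge0 ?ltW.
  have tMP : tau * (M%:R * P) <= 4^-1 * (8 * n%:R) by rewrite ler_pM// ltW.
  rewrite -[leRHS]div1r ler_pdivlMr// /a.
  have -> : 2 * (tau * M%:R / (100 * n%:R)) * P = 2 * (tau * (M%:R * P)) / (100 * n%:R).
    by ring.
  rewrite ler_pdivrMr ?mulr_gt0//; lra.
have na : n%:R * a = tau * M%:R / 100 by rewrite /a; field; rewrite gt_eqF.
have -> : 3 ^+ k * s = k.+1%:R^-1.
  by rewrite /s invfM mulrA mulfV ?mul1r// gt_eqF.
rewrite na; have h1 : tau * M%:R / 100 / M%:R = tau / 100.
  by field; rewrite gt_eqF.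
have h2 : (k.+1%:R^-1 + k.+1%:R^-1) * (tau * M%:R / 100 / 2) =
    tau * (M%:R / k.+1%:R) / 100.
  by field; rewrite addrC natr1 gt_eqF.
have h3 : M%:R / k.+1%:R <= 8 :> R by rewrite ler_pdivrMr.
rewrite h1 h2; move: (M%:R / k.+1%:R : R) h3 => q q8.
have h4 : tau * q <= tau * 8 by rewrite ler_pM2l.
move: (tau : R) (tau0 : (0 : R) < tau) h4; clear => x x0 x8.
lra.
Qed.

(** n < 2^(M+1) <= e^(M+1), and M + 1 <= 2 M since n > 1. *)
Lemma ln_le_double_trunc_log n : (1 < n)%N ->
  ln n%:R <= 2 * (trunc_log 2 n)%:R :> R.
Proof.
move=> n1; have /andP[Mn nM] := trunc_log_bounds (ltnSn 1) (ltnW n1).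
have n0 : 0 < n%:R :> R by rewrite ltr0n ltnW.
have M0 : (0 < trunc_log 2 n)%N by rewrite trunc_log_gt0.
set M := trunc_log 2 n in M0 Mn nM *.
rewrite -ler_expR lnK ?posrE//.
apply: (@le_trans _ _ (2 ^ M.+1)%:R); first by rewrite ler_nat ltnW.
apply: (@le_trans _ _ (expR M.+1%:R)).
  rewrite -[M.+1%:R]mulr1 expRM_natl natrX lerXn2r ?nnegrE ?expR_ge0//.
  by apply: le_trans (expR_ge1Dx 1).
by rewrite ler_expR -natrM ler_nat; lia.
Qed.

End numeric.

Theorem theorem3p12 (R : realType) (rho : R) (rho_gt1 : 1 < rho) :
  exists c : R, 0 < c /\
    forall (n : nat) (A : set (n.-tuple R)) (t : R),
      (1 <= n)%N -> measurable A ->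
      power_prob (boltzmann_prob (ltW rho_gt1)) n A = t%:E ->
      ((c * t * (1 - t) * (ln n%:R `^ (1 - rho^-1) / n%:R))%:E <=
        \big[maxe/-oo]_(i < n)
          geometric_influence (boltzmann_prob (ltW rho_gt1)) A i)%E.
Proof.
have rho0 : 0 < rho by exact: lt_trans ltr01 rho_gt1.
have [K K0 iso] := boltzmann_isoperimetry rho_gt1.
(* 400 = 2 * 2 * 100: the 100 of [bound_lt], a factor 2 for replacing log n with [M], and another 2
   for strictness. *)
have c0 : 0 < (400 * K)^-1 by rewrite invr_gt0 (pmulr_lgt0 _ K0) ltr0n.
exists (400 * K)^-1; split=> // n A t n1 mA At.
set nu := boltzmann_prob _ in At *; set nun := power_prob _ n in At.
have infl_ge0 i : (0 <= geometric_influence nu A i)%E.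
  by apply: integral_ge0 => x _; exact: lower_minkowski_ge0.
set b := _ * (_ / _); rewrite leNgt; apply/negP => maxb.
have inflb i : (geometric_influence nu A i < b%:E)%E.
  by apply: le_lt_trans maxb; exact: le_bigmax.
(* Influences being nonnegative, the negated bound already excludes n = 1 and t (1 - t) = 0, for
   which [b] vanishes. *)
have b0 : 0 < b by rewrite -lte_fin (le_lt_trans (infl_ge0 (Ordinal n1))).
have t01 : 0 <= t <= 1 by rewrite -!lee_fin -At measure_ge0 probability_le1.
pose alpha := 1 - rho^-1.
have alpha0 : 0 < alpha by rewrite subr_gt0 invf_lt1.
have alpha1 : alpha <= 1 by rewrite gerBl invr_ge0 ltW.
have n2 : (1 < n)%N.
  rewrite ltn_neqAle n1 andbT; apply: contraTneq b0 => n1E.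
  by rewrite /b -n1E ln1 powR0 ?gt_eqF// mul0r mulr0 ltxx.
have n0 : 0 < n%:R :> R by rewrite ltr0n.
pose tau := t * (1 - t).
have tau_gt0 : 0 < tau.
  rewrite lt_def mulr_ge0 ?subr_ge0 ?andbT; try by case/andP: t01.
  by apply: contraTneq b0 => tau0; rewrite /b -mulrA -/tau tau0 mulr0 mul0r ltxx.
have tau_le : tau <= 4^-1 by rewrite /tau; have := sqr_ge0 (t - 2^-1); lra.
pose M := trunc_log 2 n; have M0 : (0 < M)%N by rewrite trunc_log_gt0.
have M0' : 0 < M%:R :> R by rewrite ltr0n.
have /andP[Mn _] := trunc_log_bounds (ltnSn 1) n1.
pose k := (M %/ 8)%N; pose a' := tau * M%:R / (100 * n%:R).
pose s : R := (3 ^+ k * k.+1%:R)^-1.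
have [as2 lt_tau] : 2 * a' <= s ^+ 2 /\
    n%:R * a' / M%:R + (3 ^+ k * s + k.+1%:R^-1) * (n%:R * a' / 2) < tau.
  by apply: bound_lt => //; rewrite tau_gt0.
have s0 : 0 <= s by rewrite invr_ge0 mulr_ge0 ?exprn_ge0.
pose KM := K * M%:R `^ rho^-1; have KM0 : 0 < KM by rewrite mulr_gt0 ?powR_gt0.
have tent_le i : (tent_influence rho_gt1 M A i <= (KM * b)%:E)%E.
  rewrite EFinM -lee_pdivrMl//.
  rewrite /tent_influence -ge0_integralZl_EFin ?invr_ge0 ?(ltW KM0)//; first last.
  - exact: measurable_tent_section.
  - by move=> x _; rewrite lee_fin tent_section_ge0.
  (* The Minkowski content of the sections is not known to be measurable, so the integrals are
     compared through simple functions. *)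
  apply: le_trans (ltW (inflb i)); apply: le_lower_integral => x _.
    by rewrite mule_ge0// lee_fin ?invr_ge0 ?(ltW KM0)// tent_section_ge0.
  rewrite -EFinM mulrC; apply: iso => //.
  exact: measurable_axis_section.
have lt_a' : KM * b < a'.
  have lnM : ln n%:R `^ alpha <= 2 * M%:R `^ alpha.
    apply: (@le_trans _ _ ((2 * M%:R) `^ alpha)).
      apply: ge0_ler_powR; rewrite ?nnegrE ?ln_ge0 ?ler1n ?(ltW alpha0) ?mulr_ge0//.
      exact: ln_le_double_trunc_log.
    rewrite powRM// ler_wpM2r ?powR_ge0//.
    by rewrite -[leRHS]powRr1// ler_powR// ler1n.
  have MM : M%:R `^ rho^-1 * M%:R `^ alpha = M%:R.
    have e : rho^-1 + alpha = 1 by rewrite /alpha addrC subrK.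
    by rewrite -powRD e ?powRr1 ?(ltW M0')// (gt_eqF M0') implybT.
  have -> : KM * b = 400^-1 * tau * (M%:R `^ rho^-1 * ln n%:R `^ alpha) / n%:R.
    rewrite /KM /b /tau -/alpha; field; rewrite !gt_eqF//.
  have Mln : M%:R `^ rho^-1 * ln n%:R `^ alpha <= 2 * M%:R.
    rewrite -[in leRHS]MM mulrCA ler_wpM2l ?powR_ge0//.
  have -> : a' = 100^-1 * (tau * M%:R) / n%:R by rewrite /a' invfM; ring.
  rewrite ltr_pM2r ?invr_gt0//.
  have tM0 : 0 < tau * M%:R by rewrite mulr_gt0.
  have : tau * (M%:R `^ rho^-1 * ln n%:R `^ alpha) <= tau * (2 * M%:R).
    by rewrite ler_pM2l.
  rewrite [leRHS]mulrCA -[X in X < _]mulrA; move: tM0.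
  by move: (tau * M%:R : R) (tau * _ : R); clear => x y; lra.
have := power_influence_bound k M0 mA At tent_le lt_a' s0 as2.
by rewrite -/tau leNgt lt_tau.
Qed.
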